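(* Let $\nu\in\mathbb{R}$ and let $\mu$ be such that $\mu+\nu>-1$ and $\mu-\nu\in\mathbb{N}_0$. Let $\{\phi_n\}_{n=0}^{\infty}$ be the monic orthogonal polynomials with respect to the weight $w_{\mu,\nu}$ on $(0,\infty)$, and let $P_n^{(\mu,\nu)}$ denote the monic polynomial of degree $n$ satisfying $$\int_0^\infty P_n^{(\mu,\nu)}(x)\,x^{k+\mu}J_\nu(x)\,\mathrm{d}x=0,\qquad k=0,\ldots,n-1.$$ (i) If $\mu-\nu$ is even, then for each $n\geq 0$ the polynomials $P_{2n}^{(\mu,\nu)}$ and $P_{2n+1}^{(\mu,\nu)}$ exist and are given by $$P_{2n}^{(\mu,\nu)}(x)=(-1)^n\phi_n(-x^2)$$ and $$P_{2n+1}^{(\mu,\nu)}(x)=\frac{(-1)^{n+1}}{x}\left(\phi_{n+1}(-x^2)-\frac{\phi_{n+1}(0)}{\phi_n(0)}\,\phi_n(-x^2)\right).$$ (ii) If $\mu-\nu$ is odd, then for each $n\geq 0$ the polynomial $P_{2n}^{(\mu,\nu)}$ exists and is given by $P_{2n}^{(\mu,\nu)}(x)=(-1)^n\phi_n(-x^2)$, but $P_{2n+1}^{(\mu,\nu)}$ does not exist, i.e. no monic polynomial $P$ of degree $2n+1$ satisfies $\int_0^\infty P(x)\,x^{k+\mu}J_\nu(x)\,\mathrm{d}x=0$ for all $k=0,\ldots,2n$.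
   Context: $\mathbb{N}_0$ is the set of nonnegative integers. $J_\nu$ is the Bessel function of the first kind and $K_\nu$ the modified Bessel function of the second kind. Every improper integral $\int_0^\infty g(x)\,\mathrm{d}x$ is defined as its Abel limit $\lim_{s\to0^+}\int_0^\infty g(x)e^{-sx}\,\mathrm{d}x$; this applies to the orthogonality conditions defining $P_n^{(\mu,\nu)}$. Since $x^\mu J_\nu(x)$ changes sign, the existence of $P_n^{(\mu,\nu)}$ is not automatic. The weight function is, for $x>0$, $$w_{\mu,\nu}(x)=\frac{K_\nu(\sqrt{x})}{2}\cdot\begin{cases}x^{(\mu-1)/2},&\mu-\nu\text{ even},\\ x^{\mu/2},&\mu-\nu\text{ odd},\end{cases}$$ which is positive on $(0,\infty)$ with finite moments; $\phi_n$ is the monic polynomial of degree $n$ with $\int_0^\infty w_{\mu,\nu}(x)\phi_n(x)\phi_m(x)\,\mathrm{d}x=0$ for $n\neq m$. The zeros of $\phi_n$ lie in $(0,\infty)$, so $\phi_n(0)\neq 0$. *)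

(* Defs.v *)
From HB Require Import structures.
From mathcomp Require Import all_boot all_order all_algebra.
From mathcomp Require Import all_classical all_reals all_analysis.

Set Implicit Arguments.
Unset Strict Implicit.
Unset Printing Implicit Defensive.

Import Order.TTheory GRing.Theory Num.Theory numFieldNormedType.Exports.

Local Open Scope classical_set_scope.
Local Open Scope ring_scope.

(* Euler's integral, meaningful for 0 < a. *)
Definition Gamma (R : realType) (a : R) : R :=
  \int[@lebesgue_measure R]_(t in `]0, +oo[) (t `^ (a - 1) * expR (- t)).

(* The entire function 1/Gamma on the whole real line, extended from (0, +oo)
   by Gamma (a + k) = a (a + 1) ... (a + k - 1) Gamma a, with k chosen so that
   a + k > 0; it vanishes at 0, -1, -2, ... *)
Definition rGamma (R : realType) (a : R) : R :=
  let k := (Num.truncn `|a|).+1 in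
  (\prod_(j < k) (a + j%:R)) / Gamma (a + k%:R).

(* Power series, for x > 0 and any real nu. *)
Definition besselJ (R : realType) (nu x : R) : R :=
  limn (series (fun m : nat =>
    (-1) ^+ m / m`!%:R * rGamma (m%:R + nu + 1)
      * (x / 2) `^ ((2 * m)%:R + nu))).

Definition coshR (R : realType) (t : R) : R := (expR t + expR (- t)) / 2.

(* K_nu x = \int_0^oo exp (- x cosh t) cosh (nu t) dt, for x > 0 and any real
   nu, integer or not. *)
Definition besselK (R : realType) (nu x : R) : R :=
  \int[@lebesgue_measure R]_(t in `[0, +oo[)
    (expR (- (x * coshR t)) * coshR (nu * t)).

(* The Abel integral of g over (0, +oo) exists and equals l.  Rintegral is 0 on
   non-integrable functions, hence the explicit integrability clause. *)
Definition is_abel_integral (R : realType) (g : R -> R) (l : R) : Prop :=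
  (forall s : R, 0 < s ->
     (@lebesgue_measure R).-integrable `]0, +oo[
       (fun x => (g x * expR (- (s * x)))%:E)) /\
  (\int[@lebesgue_measure R]_(x in `]0, +oo[) (g x * expR (- (s * x))))
    @[s --> 0^'+] --> l.

(* Parity is read off Num.truncn (mu - nu), which is mu - nu itself when
   mu - nu is a natural number. *)
Definition weight (R : realType) (mu nu x : R) : R :=
  besselK nu (Num.sqrt x) / 2 *
    (if odd (Num.truncn (mu - nu)) then x `^ (mu / 2)
     else x `^ ((mu - 1) / 2)).

Definition monic_of_degree (R : realType) (n : nat) (P : {poly R}) : Prop :=
  P \is monic /\ size P = n.+1.

Definition is_monic_OPS (R : realType) (w : R -> R) (phi : nat -> {poly R}) :
    Prop :=
  (forall n, monic_of_degree n (phi n)) /\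
  (forall n m, n != m ->
     is_abel_integral (fun x => w x * (phi n).[x] * (phi m).[x]) 0).

Definition is_bessel_OP (R : realType) (mu nu : R) (n : nat) (P : {poly R}) :
    Prop :=
  monic_of_degree n P /\
  (forall k : nat, (k < n)%N ->
     is_abel_integral (fun x => P.[x] * x `^ (k%:R + mu) * besselJ nu x) 0).

(* Main.v *)
(* Write N = mu - nu, F_nu(x) = x^(-nu) J_nu(x), an entire even function, and
   M(b, nu, s) for the integral of x^b F_nu(x) e^(-s x), so that the moments of
   x^mu J_nu are the Abel limits of M(N + k + 2 nu, nu, s) at s = 0.  The
   relations F_nu' = - x F_(nu+1) and
   F_nu = 2 (nu + 1) F_(nu+1) - x^2 F_(nu+2) become two linear relations between
   the M's.  They give an ODE in s, whence
   M(2 nu, nu, s) = C (1 + s^2)^(- nu - 1/2) with C > 0 when nu > -1/2, and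
   they reduce every other case to this one by raising nu.  Hence the moment m_k
   of order k = N, N + 1, ... vanishes exactly for odd k, and
   m_(k+2) = - (k + 1) (k + 1 + 2 nu) m_k.  By Tonelli's theorem the moments of
   the weight are products of the integrals of x^b e^(-sqrt x) and of
   cosh (nu u) cosh(u)^(-a), and integration by parts shows that they satisfy
   the same recurrence without the sign.  So the functional of x^mu J_nu, applied
   to r (- x^2) or to x r (- x^2) according to the parity of N, is a nonzero
   multiple of the positive definite functional of the weight applied to r, and
   it kills the other parity; the rest is linear algebra of even and odd parts. *)
Require Import Defs.
From HB Require Import structures.
From mathcomp Require Import all_boot all_order all_algebra.
From mathcomp Require Import all_classical all_reals all_analysis.
From mathcomp Require Import measurable_realfun.
From mathcomp Require Import ring lra.
Import Order.TTheory GRing.Theory Num.Theory numFieldNormedType.Exports.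
Set Implicit Arguments.
Unset Strict Implicit.
Unset Printing Implicit Defensive.
Local Open Scope classical_set_scope.
Local Open Scope ring_scope.

(** * Improper integrals on the half-line *)

(** The moments of [x^mu J_nu] do not converge absolutely, so every identity is proved for [s > 0],
    where [e^(-s x)] removes all boundary terms at infinity, and the limit at [s = 0] is taken only
    in the resulting finite relations. The closed form is confined to [nu > -1/2] because [x^(2 nu)]
    is not integrable at 0 otherwise; a larger [N] admits smaller [nu], and raising [nu] by 1 while
    lowering [N] by 2 keeps the exponent [N + 2 nu], hence integrability, unchanged. The sign of [C]
    is found at one large [s], where the integral is concentrated near the origin and [F_nu] is
    close to [F_nu(0) > 0]. Both moment sequences enter the algebra only through their recurrences
    and a nonzero initial term. The algebra rests on two positivity facts for the functional [L] of
    the weight, [L(p^2) > 0] and [L(x p^2) > 0] for nonzero [p]; the second one gives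
    [phi_n(0) <> 0], and it controls the odd part of a polynomial when [N] is even. *)

Section real_derivatives.
Context {R : realType}.
Implicit Types (f g : R -> R) (a c x df dg : R).

Lemma is_derive1_continuous f x df :
  is_derive x 1 f df -> {for x, continuous f}.
Proof. by move=> [/derivable1_diffP d _]; exact: differentiable_continuous. Qed.

Lemma is_derive1D f g x df dg : is_derive x 1 f df -> is_derive x 1 g dg ->
  is_derive x 1 (fun y => f y + g y) (df + dg).
Proof. by move=> ? ?; exact: is_deriveD. Qed.

Lemma is_derive1B f g x df dg : is_derive x 1 f df -> is_derive x 1 g dg ->
  is_derive x 1 (fun y => f y - g y) (df - dg).
Proof. by move=> ? ?; exact: is_deriveB. Qed.

Lemma is_derive1M f g x df dg : is_derive x 1 f df -> is_derive x 1 g dg ->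
  is_derive x 1 (fun y => f y * g y) (df * g x + f x * dg).
Proof.
move=> dF dG; apply: is_derive_eq (is_deriveM dF dG) _.
by rewrite addrC mulrC.
Qed.

Lemma is_derive1Z c f x df : is_derive x 1 f df ->
  is_derive x 1 (fun y => c * f y) (c * df).
Proof. by move=> dF; exact: (is_deriveZ c dF). Qed.

Lemma is_derive1_cst c x : is_derive x 1 (fun=> c) 0.
Proof. exact: is_derive_cst. Qed.

Lemma is_derive1_id x : is_derive x 1 (fun y => y) 1.
Proof. exact: is_derive_id. Qed.

Lemma is_derive1_expRl c x :
  is_derive x 1 (fun y => expR (c * y)) (c * expR (c * x)).
Proof.
have d := is_derive1Z c (is_derive1_id x).
apply: is_derive_eq (is_derive1_comp (is_derive_expR _) d) _.
by rewrite mulr1 mulrC.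
Qed.

Lemma is_derive1_powR_comp f x df a : 0 < f x -> is_derive x 1 f df ->
  is_derive x 1 (fun y => f y `^ a) (a * f x `^ (a - 1) * df).
Proof. by move=> f0 d; exact: (is_derive1_comp (is_derive1_powR a f0) d). Qed.

Lemma gt0_powRD x a c : 0 < x -> x `^ (a + c) = x `^ a * x `^ c.
Proof. by move=> x0; rewrite powRD// (gt_eqF x0) implybT. Qed.

Lemma powRD1 x a : 0 < x -> x `^ (a + 1) = x * x `^ a.
Proof. by move=> x0; rewrite gt0_powRD// powRr1 ?ltW// mulrC. Qed.

End real_derivatives.

Section half_line.
Context {R : realType}.
Implicit Types (f g F : R -> R) (a b s x : R).
Local Notation leb := (@lebesgue_measure R).
Local Notation "'Rp'" := (`]0%R, +oo[%classic : set R).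

Lemma half_lineP x : Rp x <-> 0 < x.
Proof. by rewrite /= in_itv/= andbT. Qed.

Lemma measurable_half_line : measurable Rp.
Proof. exact: measurable_itv. Qed.

(** The shift by 2 keeps the endpoints distinct already for [n = 0], so that the fundamental theorem
    of calculus applies on every [exhaust n]. *)
Definition exhaust (n : nat) : set R := `[n.+2%:R^-1, n.+2%:R].

Lemma exhaust_lt n : (n.+2%:R^-1 : R) < n.+2%:R.
Proof.
apply: (@lt_trans _ _ 1); last by rewrite ltr1n.
by rewrite invf_lt1 ?ltr1n.
Qed.

Lemma exhaust_sub n : exhaust n `<=` Rp.
Proof.
move=> x; rewrite /exhaust/= !in_itv/= andbT => /andP[+ _].
by apply: lt_le_trans; rewrite invr_gt0.
Qed.

Lemma nondecreasing_exhaust : nondecreasing_seq exhaust.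
Proof.
move=> m n mn; apply/subsetPset => x; rewrite /exhaust/= !in_itv/=.
move=> /andP[mx xm]; apply/andP; split.
  by apply: le_trans mx; rewrite lef_pV2 ?posrE ?ltr0n// ler_nat.
by apply: le_trans xm _; rewrite ler_nat.
Qed.

Lemma near_exhaust x : 0 < x -> \forall n \near \oo, exhaust n x.
Proof.
move=> x0.
have := @nbhs_infty_ger R (x + x^-1).
apply: filterS => n xn; rewrite /exhaust/= in_itv/=.
have xV0 : 0 < x^-1 by rewrite invr_gt0.
have n2 : (n%:R : R) <= n.+2%:R by rewrite ler_nat ltnW.
apply/andP; split; last first.
  by rewrite (le_trans _ n2)// (le_trans _ xn)// lerDl ltW.
rewrite invf_ple ?posrE ?ltr0n//.
by rewrite (le_trans _ n2)// (le_trans _ xn)// lerDr ltW.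
Qed.

Lemma bigcup_exhaust : \bigcup_n exhaust n = Rp.
Proof.
apply/seteqP; split=> [x [n _ /exhaust_sub//]|x /half_lineP x0].
by have [N _ /(_ N (leqnn N))] := near_exhaust x0; exists N.
Qed.

Lemma cvg_exhaust_left F (l : R) : F x @[x --> 0^'+] --> l ->
  F n.+2%:R^-1 @[n --> \oo] --> l.
Proof.
move=> Fl; apply: (cvg_comp (fun n : nat => (n.+2%:R^-1 : R)) F _ Fl).
move=> A [e /= e0 Ae].
have := near_infty_natSinv_lt (PosNum e0).
apply: filterS => n /= ne; apply: Ae => /=; last by rewrite invr_gt0.
rewrite sub0r normrN ger0_norm ?invr_ge0// (le_lt_trans _ ne)//.
by rewrite lef_pV2 ?posrE ?ltr0n// ler_nat.
Qed.

Lemma cvg_exhaust_right F (l : R) : F x @[x --> +oo] --> l ->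
  F n.+2%:R @[n --> \oo] --> l.
Proof.
move=> Fl; apply: (cvg_comp (fun n : nat => (n.+2%:R : R)) F _ Fl).
apply/cvgryPge => A; have := @nbhs_infty_ger R A.
by apply: filterS => n /le_trans; apply; rewrite ler_nat ltnW.
Qed.

Section ftc.
Variables (f F : R -> R) (l0 l1 : R).
Hypothesis dF : forall x, 0 < x -> is_derive x 1 F (f x).
Hypothesis cf : forall x, 0 < x -> {for x, continuous f}.
Hypothesis F0 : F x @[x --> 0^'+] --> l0.
Hypothesis F1 : F x @[x --> +oo] --> l1.

Lemma exhaust_gt0 n x : x \in `[n.+2%:R^-1, n.+2%:R] -> 0 < x.
Proof. by move=> /exhaust_sub /half_lineP. Qed.

Lemma integral_exhaust n : (\int[leb]_(x in exhaust n) (f x)%:E =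
  (F n.+2%:R)%:E - (F n.+2%:R^-1)%:E)%E.
Proof.
have dFn x : exhaust n x -> derivable F x 1.
  by move=> /exhaust_gt0 /dF -[].
apply: continuous_FTC2.
- exact: exhaust_lt.
- apply: continuous_in_subspaceT => x /set_mem /exhaust_gt0.
  exact: cf.
- have cF x : 0 < x -> F y @[y --> x] --> F x.
    by move=> /dF[dFx _]; apply: differentiable_continuous; apply/derivable1_diffP.
  split.
  + by move=> x xn; apply/dFn/subset_itv_oo_cc.
  + by apply: cvg_at_right_filter; apply: cF; rewrite invr_gt0.
  + by apply: cvg_at_left_filter; apply: cF.
- move=> x xn; rewrite derive1E.
  have x0 : 0 < x by apply: (@exhaust_gt0 n); exact: subset_itv_oo_cc xn.
  by have [_ ->] := dF x0.
Qed.

Lemma cvg_integral_exhaust :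
  (\int[leb]_(x in exhaust n) (f x)%:E)%E @[n --> \oo] --> (l1 - l0)%:E.
Proof.
under eq_cvg do rewrite integral_exhaust.
apply: cvg_EFin; first by apply: nearW => n; rewrite -EFinB.
apply: cvgB.
  exact: (cvg_exhaust_right F1).
exact: (cvg_exhaust_left F0).
Qed.

Lemma measurable_continuous_half_line : measurable_fun Rp f.
Proof.
apply: open_continuous_measurable_fun; first exact: interval_open.
by move=> x /set_mem /half_lineP; exact: cf.
Qed.

(** Monotone convergence along [exhaust] does not presuppose integrability, so this version can be
    used to establish it: the value is finite. *)
Lemma ge0_integral_half_line_derive : (forall x, 0 < x -> 0 <= f x) ->
  (\int[leb]_(x in Rp) (f x)%:E = (l1 - l0)%:E)%E.
Proof.
move=> f0.
have mf := measurable_continuous_half_line.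
have H : (\int[leb]_(x in exhaust n) (f x)%:E)%E @[n --> \oo] -->
    (\int[leb]_(x in Rp) (f x)%:E)%E.
  rewrite -bigcup_exhaust; apply: ge0_nondecreasing_set_cvg_integral.
  - exact: nondecreasing_exhaust.
  - by move=> n; exact: measurable_itv.
  - move=> n; apply/measurable_EFinP; apply: measurable_funS mf => //.
    exact: exhaust_sub.
  - by move=> n x /exhaust_sub /half_lineP /f0; rewrite lee_fin.
exact: (cvg_unique _ H cvg_integral_exhaust).
Qed.

(** For [f] of varying sign the passage to the limit is by dominated convergence, with [|f|] as the
    bound. *)
Lemma Rintegral_half_line_derive : leb.-integrable Rp (EFin \o f) ->
  \int[leb]_(x in Rp) f x = l1 - l0.
Proof.
move=> intf.
have mf := measurable_continuous_half_line.
have H : (\int[leb]_(x in exhaust n) (f x)%:E)%E @[n --> \oo] -->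
    (\int[leb]_(x in Rp) (f x)%:E)%E.
  rewrite [X in X @ _ --> _](_ : _ = fun n =>
      (\int[leb]_(x in Rp) ((EFin \o f) \_ (exhaust n)) x)%E); last first.
    apply/funext => n; rewrite -integral_mkcondr setIidr//.
    exact: exhaust_sub.
  apply: (@dominated_cvg _ _ _ leb _ _
    (fun n => (EFin \o f) \_ (exhaust n)) _ (fun x => `|(f x)%:E|%E)) => //.
  - move=> n; apply/measurable_restrict => //.
    + exact: measurable_itv.
    + apply/measurable_EFinP; apply: measurable_funS mf => //.
  - move=> x /half_lineP x0.
    apply: cvg_near_cst; have := near_exhaust x0.
    by apply: filterS => n xn; rewrite patchE mem_set.
  - exact: integrable_abse.
  - move=> n x _; rewrite patchE; case: ifPn => // _.
    by rewrite [leLHS]abse0 abse_ge0.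
rewrite /Rintegral (cvg_unique _ H cvg_integral_exhaust)//.
Qed.

End ftc.

Lemma half_line_integrableZ c f : leb.-integrable Rp (EFin \o f) ->
  leb.-integrable Rp (EFin \o (fun x => c * f x)).
Proof.
by move=> intf; apply: (integrableZl _ c intf); exact: measurable_half_line.
Qed.

Lemma half_line_integrableD f g : leb.-integrable Rp (EFin \o f) ->
  leb.-integrable Rp (EFin \o g) ->
  leb.-integrable Rp (EFin \o (fun x => f x + g x)).
Proof.
by move=> fi gi; apply: (integrableD _ fi gi); exact: measurable_half_line.
Qed.

Lemma half_line_integrable_eq f g : (forall x, 0 < x -> f x = g x) ->
  leb.-integrable Rp (EFin \o f) -> leb.-integrable Rp (EFin \o g).
Proof.
move=> fg; apply: eq_integrable; first exact: measurable_half_line.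
by move=> x /set_mem /half_lineP x0 /=; rewrite fg.
Qed.

Lemma half_line_Rintegral_eq f g : (forall x, 0 < x -> f x = g x) ->
  \int[leb]_(x in Rp) f x = \int[leb]_(x in Rp) g x.
Proof. by move=> fg; apply: eq_Rintegral => x /set_mem /half_lineP /fg. Qed.

Lemma half_line_RintegralZ c f : leb.-integrable Rp (EFin \o f) ->
  \int[leb]_(x in Rp) (c * f x) = c * \int[leb]_(x in Rp) f x.
Proof. by move=> fi; apply: RintegralZl. Qed.

Lemma half_line_RintegralD f g : leb.-integrable Rp (EFin \o f) ->
  leb.-integrable Rp (EFin \o g) -> \int[leb]_(x in Rp) (f x + g x) =
  \int[leb]_(x in Rp) f x + \int[leb]_(x in Rp) g x.
Proof. by move=> fi gi; apply: RintegralD. Qed.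

Lemma ge0_integrable (D : set R) f : measurable D -> measurable_fun D f ->
  (forall x, D x -> 0 <= f x) -> (\int[leb]_(x in D) (f x)%:E < +oo)%E ->
  leb.-integrable D (EFin \o f).
Proof.
move=> mD mf f0 foo; apply/integrableP; split; first exact/measurable_EFinP.
apply: le_lt_trans foo; rewrite le_eqVlt; apply/orP; left; apply/eqP.
by apply: eq_integral => x /set_mem Dx /=; rewrite ger0_norm// f0.
Qed.

(** A vanishing integral would make [f] zero almost everywhere and put [E] inside a null set. Strict
    positivity is asked on [E] only, which allows polynomial factors with zeros in [D]. *)
Lemma Rintegral_gt0 (D E : set R) f : measurable D -> measurable E ->
  E `<=` D -> (0 < leb E)%E -> leb.-integrable D (EFin \o f) ->
  (forall x, D x -> 0 <= f x) -> (forall x, E x -> 0 < f x) ->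
  0 < \int[leb]_(x in D) f x.
Proof.
move=> mD mE ED E0 intf f0 fE; rewrite lt_neqAle Rintegral_ge0// andbT.
apply/eqP => /esym I0; move: E0; apply/negP; rewrite -leNgt.
have mf := measurable_int _ intf.
have : (\int[leb]_(x in D) `|(EFin \o f) x|)%E = 0.
  transitivity (\int[leb]_(x in D) (EFin \o f) x)%E.
    by apply: eq_integral => x /set_mem Dx /=; rewrite ger0_norm// f0.
  move: I0; rewrite /Rintegral => I0.
  have /fineK <- : (\int[leb]_(x in D) (f x)%:E)%E \is a fin_num.
    exact: integrable_fin_num intf.
  by rewrite I0.
move=> /ae_eq_integral_abs => /(_ mD mf)[N [mN N0 sub]].
rewrite -N0; apply: le_measure; rewrite ?inE// => x Ex; apply: sub => /=.
move=> /(_ (ED _ Ex)) [fx0]; have := fE _ Ex.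
by rewrite fx0 ltxx.
Qed.

Lemma powR_le_expR p s : 0 < s -> exists2 C, 0 < C &
  forall x, 0 <= x -> (1 + x) `^ p <= C * expR (s * x).
Proof.
move=> s0; have [p0|p0] := leP p 0.
  exists 1 => // x x0; rewrite mul1r.
  apply: (@le_trans _ _ 1); last by rewrite -expR0 ler_expR mulr_ge0// ltW.
  rewrite -[leRHS](powRr0 (1 + x)); apply: ler_powR => //.
  by rewrite lerDl.
(* From [e <= 1], [e (1 + x) <= 1 + e x <= expR (e x)]; from [p e <= s], raising to the power [p]
   leaves an exponent of at most [s x]. *)
pose e := Num.min 1 (s / p).
have e0 : 0 < e by rewrite lt_min ltr01 divr_gt0.
exists (e `^ (- p)); first exact: powR_gt0.
move=> x x0.
have xe : 1 + x <= e^-1 * expR (e * x).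
  rewrite mulrC ler_pdivlMr// (le_trans _ (expR_ge1Dx _))//.
  rewrite mulrDl mul1r mulrC lerD2r.
  by rewrite ge_min lexx.
apply: (@le_trans _ _ ((e^-1 * expR (e * x)) `^ p)).
  by apply: ge0_ler_powR; rewrite ?nnegrE ?(ltW p0) ?addr_ge0 ?mulr_ge0 ?invr_ge0 ?expR_ge0 ?(ltW e0).
rewrite powRM ?invr_ge0 ?expR_ge0 ?(ltW e0)//.
rewrite -powR_inv1 ?(ltW e0)// -powRrM mulN1r -expRM.
rewrite ler_wpM2l ?powR_ge0// ler_expR mulrAC ler_wpM2r//.
by rewrite -ler_pdivlMr// ge_min lexx orbT.
Qed.

(* [x ^ a (1 + x) ^ (- a - 2)] is, up to the factor [a + 1], the derivative of
   the bounded function [(x / (1 + x)) ^ (a + 1)]. *)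
Lemma integrable_powR_model a : -1 < a ->
  leb.-integrable Rp (EFin \o (fun x => x `^ a * (1 + x) `^ (- a - 2))).
Proof.
move=> a1.
have a10 : 0 < a + 1 by lra.
pose F x : R := x `^ (a + 1) * (1 + x) `^ (- a - 1).
pose g x : R := x `^ a * (1 + x) `^ (- a - 2).
have dg b c x : 0 < x -> is_derive x 1 (fun x => x `^ b * (1 + x) `^ c)
    (b * x `^ (b - 1) * (1 + x) `^ c + x `^ b * (c * (1 + x) `^ (c - 1))).
  move=> x0; apply: is_derive1M; first exact: is_derive1_powR.
  have d1 := is_derive1D (is_derive1_cst 1 x) (is_derive1_id x).
  apply: is_derive_eq (is_derive1_powR_comp c _ d1) _; first by rewrite addr_gt0.
  by rewrite add0r mulr1.
have dF x : 0 < x -> is_derive x 1 F ((a + 1) * g x).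
  move=> x0; apply: is_derive_eq (dg _ _ _ x0) _.
  have x10 : 0 < 1 + x by rewrite addr_gt0.
  rewrite /g addrK.
  have -> : - a - 1 = (- a - 2) + 1 by ring.
  rewrite (_ : - a - 2 + 1 - 1 = - a - 2); last by ring.
  by rewrite !powRD1//; ring.
have FE x : 0 < x -> F x = (x / (1 + x)) `^ (a + 1).
  move=> x0; have x10 : 0 < 1 + x by rewrite addr_gt0.
  rewrite powRM ?invr_ge0 ?ltW// -powR_inv1 ?ltW// -powRrM mulN1r /F.
  by rewrite opprD.
have F0 : F x @[x --> 0^'+] --> 0.
  apply: (@squeeze_cvgr _ _ _ _ (cst 0) (fun x => x `^ (a + 1))).
  - near=> x; have x0 : 0 < x by near: x; exact: nbhs_right_gt.
    rewrite /F mulr_ge0 ?powR_ge0//= ler_piMr ?powR_ge0//.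
    rewrite -[leRHS](powRr0 (1 + x)) ler_powR ?lerDl ?ltW//.
    by lra.
  - exact: cvg_cst.
  - exact: powR_cvg0.
have F1 : F x @[x --> +oo] --> (1 : R).
  have q1 : 1 - (1 + x)^-1 @[x --> +oo] --> (1 : R).
    rewrite -[X in _ --> X]subr0; apply: cvgB; first exact: cvg_cst.
    apply/gtr0_cvgV0.
      near=> x; rewrite addr_gt0//; near: x; exact: nbhs_pinfty_gt.
    exact: cvg_addrl.
  apply: (@cvg_trans _ ((1 - (1 + x)^-1) `^ (a + 1) @[x --> +oo])).
    apply: near_eq_cvg; near=> x.
    have x0 : 0 < x by near: x; exact: nbhs_pinfty_gt.
    rewrite FE//; congr (_ `^ _).
    by field; rewrite gt_eqF ?addr_gt0.
  have /is_derive1_continuous c1 := is_derive1_powR (a + 1) (@ltr01 R).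
  by have := cvg_comp _ _ q1 c1; rewrite powR1.
have cg x : 0 < x -> {for x, continuous g}.
  by move=> x0; exact: is_derive1_continuous (dg _ _ _ x0).
have I1 : (\int[leb]_(x in Rp) ((a + 1) * g x)%:E = (1 - 0)%:E)%E.
  apply: (@ge0_integral_half_line_derive _ F) => //.
  - move=> x x0; apply: continuousM; [exact: cst_continuous|exact: cg].
  - by move=> x _; rewrite /g !mulr_ge0 ?powR_ge0// ltW.
have mg : measurable_fun Rp g by exact: measurable_continuous_half_line.
have : leb.-integrable Rp (EFin \o (fun x => (a + 1) * g x)).
  apply: ge0_integrable => //.
  - exact: measurable_funM.
  - by move=> x _; rewrite /g !mulr_ge0 ?powR_ge0// ltW.
  - by rewrite I1 ltry.
move=> /(half_line_integrableZ (a + 1)^-1).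
by apply: half_line_integrable_eq => x _; rewrite mulKf// gt_eqF.
Unshelve. all: end_near. Qed.


(* [f] is [O(x ^ a)] at the origin and decays at infinity faster than any
   power. *)
Definition rapid a f := forall p, exists C, forall x, 0 < x ->
  `|f x| <= C * (x `^ a * (1 + x) `^ p).

Lemma rapid_integrable a f : -1 < a -> measurable_fun Rp f -> rapid a f ->
  leb.-integrable Rp (EFin \o f).
Proof.
move=> a1 mf /(_ (- a - 2))[C fC].
have := half_line_integrableZ C (integrable_powR_model a1).
apply: le_integrable => //; first exact/measurable_EFinP.
move=> x /half_lineP /fC /=; rewrite lee_fin => /le_trans; apply.
exact: ler_norm.
Qed.

Lemma rapid_cvg0 a f : 0 < a -> rapid a f -> f x @[x --> 0^'+] --> 0.
Proof.
move=> a0 /(_ 0)[C fC]; apply: norm_cvg0.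
apply: (@squeeze_cvgr _ _ _ _ (cst 0) (fun x => C * x `^ a)).
- near=> x; have x0 : 0 < x by near: x; exact: nbhs_right_gt.
  by rewrite normr_ge0/=; have := fC _ x0; rewrite powRr0 mulr1.
- exact: cvg_cst.
- by rewrite -[X in _ --> X](mulr0 C); apply: cvgM; [exact: cvg_cst|exact: powR_cvg0].
Unshelve. all: end_near. Qed.

Lemma rapid_cvgy a f : 0 <= a -> rapid a f -> f x @[x --> +oo] --> 0.
Proof.
move=> a0 /(_ (- a - 1))[C fC]; apply: norm_cvg0.
have C0 : 0 <= C.
  have := le_trans (normr_ge0 _) (fC 1 ltr01).
  by rewrite pmulr_lge0// mulr_gt0// powR_gt0.
apply: (@squeeze_cvgr _ _ _ _ (cst 0) (fun x => C * (1 + x)^-1)).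
- near=> x; have x0 : 0 < x by near: x; exact: nbhs_pinfty_gt.
  rewrite normr_ge0/=; apply: (le_trans (fC _ x0)); rewrite ler_wpM2l//.
  have x10 : 0 < 1 + x by rewrite addr_gt0.
  rewrite gt0_powRD// powRN powR_inv1 ?(ltW x10)// mulrA ler_piMl//.
    by rewrite invr_ge0 ltW.
  rewrite ler_pdivrMr ?powR_gt0// mul1r.
  by rewrite ge0_ler_powR ?nnegrE ?(ltW x0) ?(ltW x10) ?lerDr.
- exact: cvg_cst.
- rewrite -[X in _ --> X](mulr0 C); apply: cvgM; first exact: cvg_cst.
  apply/gtr0_cvgV0; last exact: cvg_addrl.
  by near=> x; rewrite addr_gt0//; near: x; exact: nbhs_pinfty_gt.
Unshelve. all: end_near. Qed.

Lemma rapidD a f g : rapid a f -> rapid a g -> rapid a (fun x => f x + g x).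
Proof.
move=> fa ga p; have [C fC] := fa p; have [D gD] := ga p.
exists (C + D) => x x0; rewrite (le_trans (ler_normD _ _))// mulrDl.
by rewrite lerD ?fC ?gD.
Qed.

Lemma rapidZ a c f : rapid a f -> rapid a (fun x => c * f x).
Proof.
move=> fa p; have [C fC] := fa p.
by exists (`|c| * C) => x x0; rewrite normrM -mulrA ler_wpM2l ?fC.
Qed.

Lemma rapid_le a C f g : (forall x, 0 < x -> `|g x| <= C * `|f x|) ->
  rapid a f -> rapid a g.
Proof.
move=> gf fa p; have [D fD] := fa p; exists (`|C| * D) => x x0.
apply: (le_trans (gf _ x0)); rewrite -mulrA.
apply: (@le_trans _ _ (`|C| * `|f x|)); first by rewrite ler_wpM2r// ler_norm.
by rewrite ler_wpM2l// fD.
Qed.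

Lemma rapid_powR a b f : rapid a f -> rapid (b + a) (fun x => x `^ b * f x).
Proof.
move=> fa p; have [C fC] := fa p; exists C => x x0.
rewrite normrM ger0_norm ?powR_ge0// gt0_powRD// -mulrA mulrCA ler_wpM2l ?powR_ge0//.
exact: fC.
Qed.

(** Since [x^(a - b) <= (1 + x)^(a - b)], the excess at infinity is absorbed by using the bound for
    [f] at the exponent [p + b - a]. *)
Lemma rapidW a b f : b <= a -> rapid a f -> rapid b f.
Proof.
move=> ba fa p; have [C fC] := fa (p + b - a); exists `|C| => x x0.
have x10 : 0 < 1 + x by rewrite addr_gt0.
apply: (le_trans (fC _ x0)); apply: (@le_trans _ _ (`|C| * (x `^ a * (1 + x) `^ (p + b - a)))).
  by rewrite ler_wpM2r ?ler_norm// mulr_ge0 ?powR_ge0.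
rewrite ler_wpM2l//.
have -> : x `^ a = x `^ b * x `^ (a - b) by rewrite -gt0_powRD// subrKC.
rewrite -mulrA ler_wpM2l ?powR_ge0//.
have -> : p + b - a = - (a - b) + p by ring.
rewrite (gt0_powRD _ _ x10) mulrA ler_piMl ?powR_ge0// powRN.
rewrite ler_pdivrMr ?powR_gt0// mul1r.
by rewrite ge0_ler_powR ?nnegrE ?subr_ge0 ?(ltW x0) ?(ltW x10) ?lerDr.
Qed.

Lemma rapidM a q D f g : (forall x, 0 < x -> `|g x| <= D * (1 + x) `^ q) ->
  rapid a f -> rapid a (fun x => g x * f x).
Proof.
move=> gD fa p; have [C fC] := fa (p - q); exists (D * C) => x x0.
have x10 : 0 < 1 + x by rewrite addr_gt0.
have -> : p = q + (p - q) by ring.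
rewrite normrM gt0_powRD//.
apply: (le_trans (ler_pM _ _ (gD _ x0) (fC _ x0))) => //.
by rewrite le_eqVlt; apply/orP; left; apply/eqP; ring.
Qed.

Lemma rapid_expR s : 0 < s -> rapid 0 (fun x => expR (- (s * x))).
Proof.
move=> s0 p; have [C C0 hC] := powR_le_expR (- p) s0.
exists C => x x0; have x10 : 0 < 1 + x by rewrite addr_gt0.
rewrite ger0_norm ?expR_ge0// powRr0 mul1r expRN.
rewrite -ler_pdivrMr ?powR_gt0// -powRN ler_pdivrMl ?expR_gt0// mulrC.
by apply: (le_trans (hC _ (ltW x0))).
Qed.

Lemma rapid_expR_sqrt c : 0 < c -> rapid 0 (fun x => expR (- (c * Num.sqrt x))).
Proof.
(* As [(1 + sqrt x)^2 >= 1 + x], the exponent [2 q] in [sqrt x] yields [q] in [x]; the maximum with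
   0 makes [y^q] monotone in [y]. *)
move=> c0 p; pose q := Num.max 0 (- p).
have [C C0 hC] := powR_le_expR (2 * q) c0.
exists C => x x0; have x10 : 0 < 1 + x by rewrite addr_gt0.
rewrite ger0_norm ?expR_ge0// powRr0 mul1r expRN.
rewrite -ler_pdivrMr ?powR_gt0// -powRN ler_pdivrMl ?expR_gt0// mulrC.
apply: le_trans (hC _ (sqrtr_ge0 x)).
apply: (@le_trans _ _ ((1 + x) `^ q)).
  by rewrite ler_powR ?lerDl ?(ltW x0)// le_max lexx orbT.
rewrite powRrM ge0_ler_powR ?nnegrE ?powR_ge0 ?(ltW x10)// ?le_max ?lexx//.
have s0 := sqrtr_ge0 x.
rewrite powR_mulrn ?addr_ge0// sqrrD sqr_sqrtr ?(ltW x0)// expr1n mul1r.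
by rewrite lerD2r lerDl mulrn_wge0.
Qed.

(** The common form of most integrations by parts below. [F] must vanish at 0, whence [0 < a], while
    its derivative need only be integrable there, whence [-1 < b]; in the uses [b = a - 1]. *)
Lemma rapid_Rintegral_derive a b F f :
  (forall x, 0 < x -> is_derive x 1 F (f x)) ->
  (forall x, 0 < x -> {for x, continuous f}) ->
  0 < a -> rapid a F -> -1 < b -> rapid b f ->
  \int[leb]_(x in Rp) f x = 0.
Proof.
move=> dF cf a0 aF b1 bf; rewrite -[RHS](subrr 0).
apply: (Rintegral_half_line_derive dF cf).
- exact: rapid_cvg0 aF.
- exact: rapid_cvgy (ltW a0) aF.
- apply: (rapid_integrable b1) bf.
  exact: measurable_continuous_half_line.
Qed.

End half_line.

(** * Bessel functions of the first kind *)

Section gamma_function.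
Context {R : realType}.
Implicit Types (a s x : R).
Local Notation leb := (@lebesgue_measure R).
Local Notation "'Rp'" := (`]0%R, +oo[%classic : set R).

(** This is [Gamma (a + 1) / s^(a + 1)]. The parameter [s] serves both [Gamma], at [s = 1], and the
    comparison with [laplace] at large [s]. *)
Definition powR_laplace a s : R := \int[leb]_(x in Rp) (x `^ a * expR (- (s * x))).

Lemma rapid_powR_expR a s : 0 < s -> rapid a (fun x => x `^ a * expR (- (s * x))).
Proof. by move=> s0; have := rapid_powR a (rapid_expR s0); rewrite addr0. Qed.

Lemma is_derive_powR_expR a s x : 0 < x ->
  is_derive x 1 (fun x => x `^ a * expR (- (s * x)))
    (a * (x `^ (a - 1) * expR (- (s * x))) - s * (x `^ a * expR (- (s * x)))).
Proof.
move=> x0; have d1 := is_derive1_expRl (- s) x.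
have := is_derive1M (is_derive1_powR a x0) d1.
under [in X in is_derive _ _ X _ -> _]eq_fun do rewrite mulNr.
by move=> /is_derive_eq; apply; rewrite mulNr; ring.
Qed.

Lemma continuous_powR_expR a s x : 0 < x ->
  {for x, continuous (fun x => x `^ a * expR (- (s * x)))}.
Proof. by move=> x0; exact: is_derive1_continuous (is_derive_powR_expR a s x0). Qed.

Lemma integrable_powR_expR a s : -1 < a -> 0 < s ->
  leb.-integrable Rp (EFin \o (fun x => x `^ a * expR (- (s * x)))).
Proof.
move=> a1 s0; apply: (rapid_integrable a1); last exact: rapid_powR_expR.
by apply: measurable_continuous_half_line => x; exact: continuous_powR_expR.
Qed.

Lemma powR_laplaceS a s : -1 < a -> 0 < s -> (a + 1) * powR_laplace a s = s * powR_laplace (a + 1) s.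
Proof.
move=> a1 s0; have a10 : 0 < a + 1 by lra.
apply/eqP; rewrite -subr_eq0 -mulNr; apply/eqP.
have a2 : -1 < a + 1 by lra.
rewrite /powR_laplace -!half_line_RintegralZ ?integrable_powR_expR//.
rewrite -half_line_RintegralD; try exact/half_line_integrableZ/integrable_powR_expR.
apply: (@rapid_Rintegral_derive _ (a + 1) a
  (fun x => x `^ (a + 1) * expR (- (s * x)))) => //.
- move=> x x0; apply: is_derive_eq (is_derive_powR_expR _ _ x0) _.
  by rewrite addrK mulNr.
- move=> x x0; apply: continuousD; (apply: continuousM; [exact: cst_continuous|]);
    exact: continuous_powR_expR.
- exact: rapid_powR_expR.
- apply: rapidD; apply: rapidZ; first exact: rapid_powR_expR.
  by apply: rapidW (rapid_powR_expR _ s0); rewrite lerDl.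
Qed.

Lemma half_line_Rintegral_gt0 (f : R -> R) : leb.-integrable Rp (EFin \o f) ->
  (forall x, 0 < x -> 0 < f x) -> 0 < \int[leb]_(x in Rp) f x.
Proof.
move=> intf f0; apply: (@Rintegral_gt0 _ Rp Rp) => //.
- by rewrite lebesgue_measure_itv/= ltry oppr0 addye ?ltry.
- by move=> x /half_lineP /f0 /ltW.
- by move=> x /half_lineP /f0.
Qed.

Lemma powR_laplace_gt0 a s : -1 < a -> 0 < s -> 0 < powR_laplace a s.
Proof.
move=> a1 s0; apply: half_line_Rintegral_gt0; first exact: integrable_powR_expR.
by move=> x x0; rewrite mulr_gt0 ?powR_gt0 ?expR_gt0.
Qed.

Lemma GammaE a : Gamma a = powR_laplace (a - 1) 1.
Proof. by apply: eq_Rintegral => x _; rewrite mul1r. Qed.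

Lemma Gamma_gt0 a : 0 < a -> 0 < Gamma a.
Proof. by move=> a0; rewrite GammaE powR_laplace_gt0//; lra. Qed.

Lemma GammaS a : 0 < a -> Gamma (a + 1) = a * Gamma a.
Proof.
move=> a0; rewrite !GammaE addrK -[LHS]mul1r.
have := @powR_laplaceS (a - 1) 1; rewrite subrK => <- //; lra.
Qed.

Lemma addr_truncnS_gt0 a : 0 < a + (Num.truncn `|a|).+1%:R.
Proof.
have : `|a| < (Num.truncn `|a|).+1%:R by exact: truncnS_gt.
by rewrite -ltrBlDl sub0r; apply: le_lt_trans; rewrite -normrN ler_norm.
Qed.

(** By the functional equation of [Gamma] the quotient is unchanged when [k] grows by 1, so every
    admissible shift gives the same value as the one fixed in [rGamma]. *)
Lemma rGammaE a k : 0 < a + k%:R ->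
  rGamma a = (\prod_(j < k) (a + j%:R)) / Gamma (a + k%:R).
Proof.
pose q k := (\prod_(j < k) (a + j%:R)) / Gamma (a + k%:R).
have qS j : 0 < a + j%:R -> q j.+1 = q j.
  move=> aj; rewrite /q big_ord_recr/= -natr1 addrA GammaS//.
  have G0 : Gamma (a + j%:R) != 0 by rewrite gt_eqF// Gamma_gt0.
  by field; rewrite G0 gt_eqF.
have qD j i : 0 < a + j%:R -> q (j + i)%N = q j.
  move=> aj; elim: i => [|i <-]; first by rewrite addn0.
  by rewrite addnS qS// natrD addrA ltr_wpDr.
rewrite -/(q k) => ak; rewrite /rGamma -/(q _).
set m := _.+1; have am : 0 < a + m%:R by exact: addr_truncnS_gt0.
by have [/subnKC <-|/ltnW/subnKC <-] := leqP m k; rewrite qD.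
Qed.

Lemma rGammaS a : rGamma a = a * rGamma (a + 1).
Proof.
pose k := (Num.truncn `|a|).+1; have ak : 0 < a + k%:R.
  exact: addr_truncnS_gt0.
have ak1 : 0 < a + 1 + k%:R by rewrite addrAC ltr_wpDr.
(* The shifts [k] at [a + 1] and [k + 1] at [a] lead to the same value of [Gamma]; the products
   differ by the factor [a]. *)
rewrite (rGammaE ak1) (@rGammaE a k.+1); last by rewrite -natr1 addrA addrAC.
rewrite big_ord_recl/= addr0 -mulrA; congr (_ * (_ / Gamma _)).
  by apply: eq_bigr => i _; rewrite -addrA nat1r.
by rewrite -natr1; ring.
Qed.

Lemma rGamma_gt0 a : 0 < a -> 0 < rGamma a.
Proof.
move=> a0; rewrite (@rGammaE a 0) ?addr0// big_ord0 divr_gt0 ?Gamma_gt0//.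
Qed.

End gamma_function.

Section bessel_series.
Context {R : realType}.
Implicit Types (nu x z : R).

(** Coefficients of [(x / 2)^(- nu) J_nu x] as a power series in [z = x^2]. *)
Definition bessel_coef nu (m : nat) : R :=
  (-1) ^+ m / m`!%:R * rGamma (m%:R + nu + 1) / 4 ^+ m.

(** By [rGammaS] the absolute values do not increase with [m] once [m + nu + 1 >= 1]; the finitely
    many earlier ones are bounded by their sum. *)
Lemma rGamma_bounded nu : exists2 C, 0 <= C & forall m : nat,
  `|rGamma (m%:R + nu + 1)| <= C.
Proof.
pose r (m : nat) := rGamma (m%:R + nu + 1).
pose N := (Num.truncn `|nu|).+1.
have Nnu : 0 < nu + N%:R by exact: addr_truncnS_gt0.
exists (\sum_(i < N.+1) `|r i|); first exact: sumr_ge0.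
have init m : (m <= N)%N -> `|r m| <= \sum_(i < N.+1) `|r i|.
  move=> mN; rewrite (bigD1 (Ordinal (mN : (m < N.+1)%N)))//= lerDl.
  exact: sumr_ge0.
elim=> [|m IH]; first exact: init.
have [mN|Nm] := ltnP m N; first exact: init.
apply: le_trans IH.
have mnu : 1 <= m%:R + nu + 1.
  rewrite lerDr; apply: ltW; apply: (lt_le_trans Nnu).
  by rewrite addrC lerD2r ler_nat.
rewrite [in leRHS]rGammaS [leRHS]normrM.
have -> : m.+1%:R + nu + 1 = m%:R + nu + 1 + 1 by rewrite -natr1; ring.
by rewrite ler_peMl// (le_trans mnu)// ler_norm.
Qed.

(** Comparison with the exponential series, as the values of [rGamma] are bounded and [4^m >= 1]. *)
Lemma is_cvg_bessel_series nu z : cvgn (pseries (bessel_coef nu) z).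
Proof.
have [C C0 hC] := rGamma_bounded nu.
apply: normed_cvg.
apply: (@series_le_cvg _ _ (C \*: (exp_coeff `|z|))) => [n|n|n|].
- exact: normr_ge0.
- by rewrite mulr_ge0// exp_coeff_ge0.
- rewrite /= /exp_coeff /= /bessel_coef; move: (hC n).
  move: (rGamma _) => r rC.
  rewrite !normrM normrX normrN1 expr1n mul1r !normfV !normrX !normr_nat.
  rewrite [leLHS](_ : _ = (`|r| / 4 ^+ n) * (`|z| ^+ n / n`!%:R)); last by ring.
  apply: ler_wpM2r; first by rewrite mulr_ge0 ?invr_ge0 ?exprn_ge0.
  rewrite ler_pdivrMr ?exprn_gt0// (le_trans rC)// ler_peMr//.
  by rewrite exprn_ege1// ler1n.
- by apply: is_cvg_seriesZ; exact: is_cvg_series_exp_coeff.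
Qed.

Definition bessel_entire nu z : R := limn (pseries (bessel_coef nu) z).

Lemma bessel_coefS nu m : m.+1%:R * bessel_coef nu m.+1 =
  - 4^-1 * bessel_coef (nu + 1) m.
Proof.
rewrite /bessel_coef factS natrM !exprS -natr1.
have -> : m%:R + (nu + 1) + 1 = m%:R + 1 + nu + 1 by ring.
field; rewrite ?expf_neq0 ?pnatr_eq0 -?lt0n ?fact_gt0//=.
Qed.

Lemma bessel_coef_contiguous nu m : bessel_coef nu m =
  (m%:R + (nu + 1)) * bessel_coef (nu + 1) m.
Proof.
rewrite /bessel_coef rGammaS.
have -> : m%:R + (nu + 1) + 1 = m%:R + nu + 1 + 1 by ring.
by ring.
Qed.

Lemma pseries_diffs_bessel nu : pseries_diffs (bessel_coef nu) =
  (fun m => - 4^-1 * bessel_coef (nu + 1) m).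
Proof. by apply/funext => m; rewrite /pseries_diffs bessel_coefS. Qed.

Lemma pseriesZ (c : R) (u : nat -> R) z :
  pseries (fun m => c * u m) z = (fun n => c * pseries u z n).
Proof.
apply/funext => n; rewrite /pseries /series /= mulr_sumr.
by apply: eq_bigr => i _; rewrite mulrA.
Qed.

Lemma is_cvg_pseriesZ (c : R) (u : nat -> R) z : cvgn (pseries u z) ->
  cvgn (pseries (fun m => c * u m) z).
Proof. by move=> cu; rewrite pseriesZ; apply: is_cvgM => //; exact: is_cvg_cst. Qed.

Lemma lim_pseriesZ (c : R) (u : nat -> R) z : cvgn (pseries u z) ->
  limn (pseries (fun m => c * u m) z) = c * limn (pseries u z).
Proof.
move=> cu; rewrite pseriesZ; apply/cvg_lim => //.
by apply: cvgM => //; exact: cvg_cst.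
Qed.

Lemma is_derive_bessel_entire nu z :
  is_derive z 1 (bessel_entire nu) (- 4^-1 * bessel_entire (nu + 1) z).
Proof.
rewrite /bessel_entire -lim_pseriesZ; last exact: is_cvg_bessel_series.
rewrite -pseries_diffs_bessel.
have dZ (c : R) (u : nat -> R) :
    pseries_diffs (fun m => c * u m) = (fun m => c * pseries_diffs u m).
  by apply/funext => m; rewrite /pseries_diffs mulrCA.
apply: (@pseries_snd_diffs _ _ (`|z| + 1)).
- exact: is_cvg_bessel_series.
- rewrite pseries_diffs_bessel; exact/is_cvg_pseriesZ/is_cvg_bessel_series.
- rewrite pseries_diffs_bessel dZ pseries_diffs_bessel.
  exact/is_cvg_pseriesZ/is_cvg_pseriesZ/is_cvg_bessel_series.
- by rewrite [ltRHS]ger0_norm ?addr_ge0// ltrDl.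
Qed.

Lemma bessel_entire_contiguous nu z : bessel_entire nu z =
  (nu + 1) * bessel_entire (nu + 1) z - z / 4 * bessel_entire (nu + 1 + 1) z.
Proof.
(* The factor [m] kills the term of index 0 and shifts the others, so the series of order [nu + 2]
   is truncated one term earlier. *)
have E n : pseries (bessel_coef nu) z n.+1 =
    (nu + 1) * pseries (bessel_coef (nu + 1)) z n.+1
    - z / 4 * pseries (bessel_coef (nu + 1 + 1)) z n.
  rewrite /pseries /series /=.
  transitivity (\sum_(0 <= m < n.+1) ((nu + 1) * (bessel_coef (nu + 1) m * z ^+ m)
      + (m%:R * bessel_coef (nu + 1) m) * z ^+ m)).
    apply: eq_bigr => m _; rewrite bessel_coef_contiguous.
    by move: (bessel_coef (nu + 1) m) => c; ring.
  rewrite big_split/= -mulr_sumr; congr (_ + _).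
  rewrite big_nat_recl// !mul0r add0r mulr_sumr -sumrN; apply: eq_bigr => i _.
  rewrite bessel_coefS exprS.
  by move: (bessel_coef (nu + 1 + 1) i) => c; ring.
have cS mu : pseries (bessel_coef mu) z n.+1 @[n --> \oo] --> bessel_entire mu z.
  by rewrite (cvg_shiftS (pseries (bessel_coef mu) z)); exact: is_cvg_bessel_series.
apply/cvg_lim => //; rewrite -(cvg_shiftS (pseries (bessel_coef nu) z)).
under eq_cvg do rewrite /= E.
apply: cvgB; apply: cvgM; try exact: cvg_cst; first exact: cS.
exact: is_cvg_bessel_series.
Qed.

Lemma bessel_entire0 nu : bessel_entire nu 0 = rGamma (nu + 1).
Proof.
apply/cvg_lim => //; rewrite -cvg_shiftS; apply: cvg_near_cst.
apply: nearW => n; rewrite /pseries /series /= big_nat_recl// big1 ?addr0.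
  by rewrite /bessel_coef !expr0 fact0 !divr1 mul1r !mulr1 add0r.
by move=> i _; rewrite expr0n mulr0.
Qed.

End bessel_series.

(* [besselF nu x = x ^ (- nu) J_nu x] is an entire even function of [x]. *)
HB.lock Definition besselF (R : realType) (nu x : R) : R :=
  2 `^ (- nu) * bessel_entire nu (x ^+ 2).

Section bessel_function.
Context {R : realType}.
Implicit Types (nu x : R).

Lemma besselJE nu x : 0 < x -> besselJ nu x = x `^ nu * besselF nu x.
Proof.
move=> x0; rewrite besselF.unlock /bessel_entire mulrA -lim_pseriesZ; last first.
  exact: is_cvg_bessel_series.
congr (limn _); apply/funext => n; rewrite /pseries /series /=.
apply: eq_bigr => m _; rewrite /bessel_coef.
move: (rGamma _) => r.
rewrite powRD; last by rewrite implybE; apply/orP; right; rewrite gt_eqF ?divr_gt0.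
rewrite powR_mulrn ?divr_ge0 ?(ltW x0)// powRM ?invr_ge0 ?(ltW x0)//.
rewrite -[2^-1]powR_inv1// -powRrM mulN1r powR_inv1//.
rewrite exprMn exprVn !exprM (_ : 2 ^+ 2 = 4); last by rewrite expr2 -natrM.
by ring.
Qed.

Lemma is_derive_besselF nu x :
  is_derive x 1 (besselF nu) (- x * besselF (nu + 1) x).
Proof.
have d2 : is_derive x 1 (fun y : R => y ^+ 2) (2 * x).
  by apply: is_derive_eq (is_derive1M (is_derive1_id x) (is_derive1_id x)) _; ring.
have d := @is_derive1_comp _ _ (fun y => y ^+ 2) _ _ _
  (is_derive_bessel_entire nu (x ^+ 2)) d2.
rewrite besselF.unlock; apply: is_derive_eq (is_derive1Z (2 `^ (- nu)) d) _.
rewrite opprD gt0_powRD// powR_inv1//.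
by field.
Qed.

Lemma besselF_contiguous nu x : besselF nu x =
  2 * (nu + 1) * besselF (nu + 1) x - x ^+ 2 * besselF (nu + 1 + 1) x.
Proof.
rewrite besselF.unlock bessel_entire_contiguous !opprD !gt0_powRD// !powR_inv1//.
move: (bessel_entire _ _) (bessel_entire _ _) (_ `^ _) => A B c.
by field.
Qed.

Lemma besselF0_gt0 nu : -1 < nu -> 0 < besselF nu 0.
Proof.
move=> nu1; rewrite besselF.unlock expr0n /= bessel_entire0.
by rewrite mulr_gt0 ?powR_gt0// rGamma_gt0//; lra.
Qed.

(* The energy [F_nu ^ 2 + F_nu' ^ 2] is nonincreasing on [0, +oo), its
   derivative being [- 2 (2 nu + 1) x F_(nu+1) ^ 2]. *)
Lemma besselF_le nu x : - 2^-1 <= nu -> 0 <= x -> `|besselF nu x| <= besselF nu 0.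
Proof.
move=> nu2 x0; have nu1 : -1 < nu by lra.
pose E y := besselF nu y ^+ 2 + (y * besselF (nu + 1) y) ^+ 2.
have dE (y : R) : is_derive y 1 E (- 2 * (2 * nu + 1) * y * besselF (nu + 1) y ^+ 2).
  have d0 := is_derive_besselF nu y.
  have d1 := is_derive1M (is_derive1_id y) (is_derive_besselF (nu + 1) y).
  apply: is_derive_eq (is_derive1D (is_derive1M d0 d0) (is_derive1M d1 d1)) _.
  rewrite [besselF nu y]besselF_contiguous.
  by move: (besselF _ _) (besselF _ _) => A B; ring.
have cE : {within `[0, x], continuous E}.
  apply: continuous_subspaceT => y; exact: is_derive1_continuous (dE y).
have [c + Ec] := MVT_segment x0 (fun y _ => dE y) cE.
rewrite in_itv/= => /andP[c0 cx].
have Ex : E x <= E 0.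
  rewrite -subr_le0 Ec subr0 mulr_le0_ge0// mulr_le0_ge0 ?sqr_ge0//.
  by rewrite mulr_le0_ge0//; lra.
have F0 : 0 <= besselF nu 0 by rewrite ltW ?besselF0_gt0.
rewrite -ler_sqr ?nnegrE// real_normK ?num_real//.
have : E 0 = besselF nu 0 ^+ 2 by rewrite /E mul0r expr0n addr0.
by move=> <-; apply: le_trans Ex; rewrite lerDl sqr_ge0.
Qed.

(** Below [nu = -1/2] boundedness is lost, but [besselF_contiguous] expresses [F_nu] by [F_(nu+1)]
    and [F_(nu+2)] at the cost of a factor [x^2]. The index [k] counts the steps up to the range of
    [besselF_le]. *)
Lemma besselF_poly_bounded nu : exists C (q : nat), forall x, 0 <= x ->
  `|besselF nu x| <= C * (1 + x) ^+ q.
Proof.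
suff H k : forall mu, - 2^-1 <= mu + k%:R -> exists2 C, 0 <= C &
    exists q : nat, forall x, 0 <= x -> `|besselF mu x| <= C * (1 + x) ^+ q.
  have [] := H (Num.truncn `|nu|).+1 nu.
    by have := addr_truncnS_gt0 nu; lra.
  by move=> C _ [q]; exists C, q.
elim: k => [|k IH] mu muk.
  exists (besselF mu 0); first by rewrite ltW// besselF0_gt0//; lra.
  by exists 0%N => x x0; rewrite expr0 mulr1 besselF_le//; lra.
have [|C1 C10 [q1 F1]] := IH (mu + 1); first by move: muk; rewrite -natr1; lra.
have [|C2 C20 [q2 F2]] := IH (mu + 1 + 1); first by move: muk; rewrite -natr1; lra.
exists (`|2 * (mu + 1)| * C1 + C2); first by rewrite addr_ge0 ?mulr_ge0.
exists (maxn q1 q2.+2) => x x0.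
have x1 : 1 <= 1 + x by rewrite lerDl.
rewrite besselF_contiguous [leRHS]mulrDl; apply: le_trans (ler_normB _ _) _.
apply: lerD.
  rewrite normrM -mulrA ler_wpM2l// (le_trans (F1 _ x0))// ler_wpM2l//.
  by rewrite ler_weXn2l// leq_maxl.
rewrite normrM ger0_norm ?exprn_ge0//.
apply: (@le_trans _ _ (C2 * (1 + x) ^+ q2.+2)); last first.
  by rewrite ler_wpM2l// ler_weXn2l// leq_maxr.
have -> : C2 * (1 + x) ^+ q2.+2 = (1 + x) ^+ 2 * (C2 * (1 + x) ^+ q2).
  by rewrite -addn2 exprD; ring.
by rewrite ler_pM ?exprn_ge0// ?F2// ler_sqr ?nnegrE ?addr_ge0// lerDr.
Qed.

(** Mean value theorem with [F_nu' = - x F_(nu+1)], the latter factor being bounded by [besselF_le].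
    This lower bound, positive near 0, decides the sign of the transform at large [s]. *)
Lemma besselF_ge nu x : - 2^-1 <= nu -> 0 <= x ->
  besselF nu 0 - x ^+ 2 * besselF (nu + 1) 0 <= besselF nu x.
Proof.
move=> nu2 x0.
have cF : {within `[0, x], continuous (besselF nu)}.
  apply: continuous_subspaceT => y.
  exact: is_derive1_continuous (is_derive_besselF nu y).
have [c + Fc] := MVT_segment x0 (fun y _ => is_derive_besselF nu y) cF.
rewrite in_itv/= => /andP[c0 cx].
have -> : besselF nu x = besselF nu 0 - c * besselF (nu + 1) c * x.
  by move: Fc => /(canRL (subrK _)) ->; ring.
apply: lerB => //; rewrite expr2 [leRHS]mulrAC; apply: ler_wpM2r => //.
have nu3 : - 2^-1 <= nu + 1 by lra.
apply: (@le_trans _ _ (x * `|besselF (nu + 1) c|)).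
  apply: (@le_trans _ _ (c * `|besselF (nu + 1) c|)).
    by rewrite ler_wpM2l// ler_norm.
  by rewrite ler_wpM2r.
by rewrite ler_wpM2l// besselF_le.
Qed.

End bessel_function.

(** * Moments of Bessel functions of the first kind *)

Section laplace_bessel.
Context {R : realType}.
Implicit Types (nu b s x : R).
Local Notation leb := (@lebesgue_measure R).
Local Notation "'Rp'" := (`]0%R, +oo[%classic : set R).

Definition laplace_fun b nu s x : R :=
  besselF nu x * (x `^ b * expR (- (s * x))).

Definition laplace b nu s : R := \int[leb]_(x in Rp) laplace_fun b nu s x.

Lemma rapid_laplace_fun b nu s : 0 < s -> rapid b (laplace_fun b nu s).
Proof.
move=> s0; have [C [q Fq]] := besselF_poly_bounded nu.
apply: (@rapidM _ _ q%:R C); last exact: rapid_powR_expR.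
by move=> x x0; rewrite powR_mulrn ?addr_ge0 ?(ltW x0)// Fq ?ltW.
Qed.

Lemma is_derive_laplace_fun b nu s x : 0 < x ->
  is_derive x 1 (laplace_fun b nu s) (b * laplace_fun (b - 1) nu s x
    + (- 1 * laplace_fun (b + 1) (nu + 1) s x + - s * laplace_fun b nu s x)).
Proof.
move=> x0.
apply: is_derive_eq (is_derive1M (is_derive_besselF nu x) (is_derive_powR_expR b s x0)) _.
rewrite /laplace_fun powRD1//.
by move: (besselF _ _) (besselF _ _) (powR _ _) (powR _ _) (expR _) => A B D E F; ring.
Qed.

Lemma continuous_laplace_fun b nu s x : 0 < x -> {for x, continuous (laplace_fun b nu s)}.
Proof. by move=> x0; exact: is_derive1_continuous (is_derive_laplace_fun b nu s x0). Qed.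

Lemma integrable_laplace_fun b nu s : -1 < b -> 0 < s ->
  leb.-integrable Rp (EFin \o laplace_fun b nu s).
Proof.
move=> b1 s0; apply: (rapid_integrable b1); last exact: rapid_laplace_fun.
by apply: measurable_continuous_half_line => x; exact: continuous_laplace_fun.
Qed.

(** The derivative of [x^(b+1) F_nu(x) e^(-s x)] integrates to zero, [b + 1 > 0] removing the
    boundary term at the origin. *)
Lemma laplace_ibp b nu s : -1 < b -> 0 < s ->
  (b + 1) * laplace b nu s = laplace (b + 2) (nu + 1) s + s * laplace (b + 1) nu s.
Proof.
move=> b1 s0; have b2 : -1 < b + 2 by lra. have b3 : -1 < b + 1 by lra.
pose f x := (b + 1) * laplace_fun b nu s x
    + (- 1 * laplace_fun (b + 2) (nu + 1) s x + - s * laplace_fun (b + 1) nu s x).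
have : \int[leb]_(x in Rp) f x = 0.
  apply: (@rapid_Rintegral_derive _ (b + 1) b (laplace_fun (b + 1) nu s)) => //.
  - move=> x x0; apply: is_derive_eq (is_derive_laplace_fun _ _ _ x0) _.
    by rewrite addrK (_ : b + 1 + 1 = b + 2)//; ring.
  - move=> x x0; do 2 ?[apply: continuousD];
      (apply: continuousM; [exact: cst_continuous|exact: continuous_laplace_fun]).
  - lra.
  - exact: rapid_laplace_fun.
  - do 2 ?[apply: rapidD]; apply: rapidZ; first exact: rapid_laplace_fun.
    + by apply: rapidW (rapid_laplace_fun _ _ s0); lra.
    + by apply: rapidW (rapid_laplace_fun _ _ s0); lra.
rewrite half_line_RintegralD; last 2 first.
- exact/half_line_integrableZ/integrable_laplace_fun.
- apply: half_line_integrableD; exact/half_line_integrableZ/integrable_laplace_fun.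
rewrite half_line_RintegralD; try exact/half_line_integrableZ/integrable_laplace_fun.
rewrite !half_line_RintegralZ ?integrable_laplace_fun// -/(laplace _ _ _) -/(laplace _ _ _) -/(laplace _ _ _).
by move: (laplace _ _ _) (laplace _ _ _) (laplace _ _ _) => A B D H; lra.
Qed.

(** The three-term relation in [nu], with [M(b + 2, nu + 2, s)] eliminated by [laplace_ibp]. The
    order rises by 1, the second term carries a factor [s], and the coefficient of the first
    vanishes at [b = 2 nu + 1]. *)
Lemma laplace_contiguous b nu s : -1 < b -> 0 < s -> laplace b nu s =
  (2 * nu + 1 - b) * laplace b (nu + 1) s + s * laplace (b + 1) (nu + 1) s.
Proof.
move=> b1 s0; have b2 : -1 < b + 2 by lra.
have : laplace b nu s = 2 * (nu + 1) * laplace b (nu + 1) s - laplace (b + 2) (nu + 1 + 1) s.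
  rewrite -[X in _ - X]mul1r -mulNr /laplace.
  rewrite -!half_line_RintegralZ ?integrable_laplace_fun//.
  rewrite -half_line_RintegralD; try exact/half_line_integrableZ/integrable_laplace_fun.
  apply: half_line_Rintegral_eq => x x0; rewrite /laplace_fun besselF_contiguous.
  rewrite gt0_powRD// powR_mulrn ?ltW//.
  by move: (besselF _ _) (besselF _ _) (powR _ _) (expR _) => A B D E; ring.
have := laplace_ibp (nu + 1) b1 s0.
by move: (laplace _ _ _) (laplace _ _ _) (laplace _ _ _) (laplace _ _ _) => A B D E H1 ->; lra.
Qed.

Lemma is_derive_laplace b nu s : -1 < b -> 0 < s ->
  is_derive s 1 (laplace b nu) (- laplace (b + 1) nu s).
Proof.
move=> b1 s0; have b2 : -1 < b + 1 by lra.
pose h t x := laplace_fun b nu t x.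
have dh (t x : R) : 0 < x -> is_derive t 1 (h ^~ x) (- laplace_fun (b + 1) nu t x).
  move=> x0.
  have d := is_derive1_expRl (- x) t.
  have := is_derive1Z (besselF nu x * x `^ b) d.
  have -> : (fun y => besselF nu x * x `^ b * expR (- x * y)) = h ^~ x.
    by apply/funext => y; rewrite /h /laplace_fun mulrA mulNr [x * y]mulrC.
  move=> /is_derive_eq; apply.
  rewrite /laplace_fun powRD1// (_ : - x * t = - (t * x)); last by ring.
  by move: (besselF _ _) (powR _ _) (expR _) => A B D; ring.
have s2 : 0 < s / 2 by rewrite divr_gt0.
have Is : `](s / 2), (2 * s)[%classic s by rewrite /= in_itv/=; apply/andP; split; lra.
(* The absolute value of the integrand decreases in [t], so on [(s / 2, 2 s)] it is dominated by its
   value at [s / 2]. *)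
pose G x := `|laplace_fun (b + 1) nu (s / 2) x|.
have ph t x : 0 < x -> partial1of2 h t x = - laplace_fun (b + 1) nu t x.
  by move=> x0; rewrite partial1of2E; have [_ ->] := dh t x x0.
have inth t : `](s / 2), (2 * s)[%classic t -> leb.-integrable Rp (EFin \o h t).
  move=> /=; rewrite in_itv/= => /andP[st _]; apply: integrable_laplace_fun => //.
  exact: lt_trans st.
have derh t x : `](s / 2), (2 * s)[%classic t -> Rp x -> derivable (h ^~ x) t 1.
  by move=> _ /half_lineP x0; have [] := dh t x x0.
have intG : leb.-integrable Rp (EFin \o G).
  exact/integrable_norm/integrable_laplace_fun.
have Gub t x : `](s / 2), (2 * s)[%classic t -> Rp x -> `|partial1of2 h t x| <= G x.
  move=> /=; rewrite in_itv/= => /andP[st _] /half_lineP x0.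
  rewrite ph// normrN /G /laplace_fun !normrM; do 2 (apply: ler_wpM2l => //).
  by rewrite !ger0_norm ?expR_ge0// ler_expR lerN2 ler_wpM2r ?ltW.
have G0 x : 0 <= G x by exact: normr_ge0.
have D := @derivable_under_integral _ _ _ leb h Rp measurable_half_line s _ _ Is
  inth derh G G0 intG Gub.
have V := @differentiation_under_integral _ _ _ leb h Rp measurable_half_line s _ _ Is
  inth derh G G0 intG Gub.
apply: DeriveDef; first exact: D.
rewrite -derive1E V.
transitivity (\int[leb]_(x in Rp) (-1 * laplace_fun (b + 1) nu s x)).
  by apply: half_line_Rintegral_eq => x x0; rewrite ph// mulN1r.
by rewrite half_line_RintegralZ ?mulN1r// integrable_laplace_fun.
Qed.

Lemma laplace_gt0_near_infty nu : - 2^-1 < nu ->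
  exists2 s, 0 < s & 0 < laplace (2 * nu) nu s.
Proof.
move=> nu2; have b1 : -1 < 2 * nu by lra.
have b2 : -1 < 2 * nu + 1 by lra. have b3 : -1 < 2 * nu + 1 + 1 by lra.
have nn0 : 0 < (2 * nu + 1 + 1) * (2 * nu + 1) by rewrite mulr_gt0; lra.
have F0 : 0 < besselF nu 0 by apply: besselF0_gt0; lra.
have F1 : 0 < besselF (nu + 1) 0 by apply: besselF0_gt0; lra.
(* With [P a = powR_laplace a s], the transform is at least [F_nu(0) P(2 nu) - F_(nu+1)(0) P(2 nu +
   2)], and [s^2 P(2 nu + 2) = (2 nu + 2) (2 nu + 1) P(2 nu)]. The difference is positive when
   [s^2 > r], which holds for [s = 1 + r]. *)
pose r := besselF (nu + 1) 0 * ((2 * nu + 1 + 1) * (2 * nu + 1)) / besselF nu 0.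
have r0 : 0 < r by rewrite divr_gt0// mulr_gt0.
have s0 : 0 < 1 + r by rewrite addr_gt0.
exists (1 + r) => //; set s := 1 + r.
have s1 : 1 <= s by rewrite lerDl ltW.
have E : powR_laplace (2 * nu + 1 + 1) s =
    (2 * nu + 1 + 1) * (2 * nu + 1) / s ^+ 2 * powR_laplace (2 * nu) s.
  have H1 := powR_laplaceS b1 s0; have H2 := powR_laplaceS b2 s0.
  apply: (mulfI (x := s ^+ 2)); first by rewrite expf_neq0// gt_eqF.
  rewrite -/s in H1 H2.
  rewrite expr2 -[LHS]mulrA -H2 mulrCA -H1.
  by move: (powR_laplace _ _) => A; field; rewrite gt_eqF.
have G0 : 0 < powR_laplace (2 * nu) s by exact: powR_laplace_gt0.
have : besselF nu 0 * powR_laplace (2 * nu) s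
    - besselF (nu + 1) 0 * powR_laplace (2 * nu + 1 + 1) s <= laplace (2 * nu) nu s.
  rewrite -mulNr /powR_laplace -!half_line_RintegralZ ?integrable_powR_expR//.
  rewrite -half_line_RintegralD; try exact/half_line_integrableZ/integrable_powR_expR.
  apply: le_Rintegral => //.
  - apply: half_line_integrableD; exact/half_line_integrableZ/integrable_powR_expR.
  - exact: integrable_laplace_fun.
  - move=> x /half_lineP x0; rewrite !powRD1// /laplace_fun.
    apply: (@le_trans _ _ ((besselF nu 0 - x ^+ 2 * besselF (nu + 1) 0)
        * (x `^ (2 * nu) * expR (- (s * x))))).
      rewrite le_eqVlt; apply/orP; left; apply/eqP.
      by move: (besselF _ _) (besselF _ _) (powR _ _) (expR _) => A B D H; ring.
    apply: ler_wpM2r; first by rewrite mulr_ge0 ?powR_ge0 ?expR_ge0.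
    by apply: besselF_ge; rewrite ltW.
apply: lt_le_trans; rewrite E mulrA -mulrBl mulr_gt0//.
rewrite subr_gt0 mulrA ltr_pdivrMr ?exprn_gt0// -ltr_pdivrMl//.
rewrite mulrC -/r (@lt_le_trans _ _ s)//; first by rewrite ltrDr.
by rewrite expr2 ler_peMl// ltW.
Qed.

(** [laplace_ibp] at [b = 2 nu] and [laplace_contiguous] at [b = 2 nu + 1] share the term
    [M(2 nu + 2, nu + 1, s)], which is eliminated. By [is_derive_laplace] the transform on the left
    is minus the derivative of the one on the right, so this is a first-order equation. *)
Lemma laplace_ode nu s : - 2^-1 < nu -> 0 < s ->
  (1 + s ^+ 2) * laplace (2 * nu + 1) nu s = (2 * nu + 1) * s * laplace (2 * nu) nu s.
Proof.
move=> nu2 s0; have b1 : -1 < 2 * nu by lra. have b2 : -1 < 2 * nu + 1 by lra.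
have H1 := laplace_ibp nu b1 s0; have H2 := laplace_contiguous nu b2 s0.
have e : 2 * nu + 1 + 1 = 2 * nu + 2 by ring.
move: H1 H2; rewrite e subrr mul0r add0r.
by move: (laplace _ _ _) (laplace _ _ _) (laplace _ _ _) => A B D H1 H2; nra.
Qed.

Lemma laplace_closed_form nu : - 2^-1 < nu -> exists2 C, 0 < C &
  forall s, 0 < s -> laplace (2 * nu) nu s = C * (1 + s ^+ 2) `^ (- (nu + 2^-1)).
Proof.
move=> nu2; have b1 : -1 < 2 * nu by lra.
pose p s := 1 + s ^+ 2 : R.
have p0 s : 0 < p s by rewrite ltr_pwDl// sqr_ge0.
(* The transform times the integrating factor of [laplace_ode]: it is constant, and its sign is read
   at the point of [laplace_gt0_near_infty]. *)
pose H s := p s `^ (nu + 2^-1) * laplace (2 * nu) nu s.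
have dH s : 0 < s -> is_derive s 1 H 0.
  move=> s0.
  have dp : is_derive s 1 p (2 * s).
    have di := is_derive1_id s.
    by apply: is_derive_eq (is_derive1D (is_derive1_cst 1 s) (is_derive1M di di)) _; ring.
  apply: is_derive_eq (is_derive1M (is_derive1_powR_comp (nu + 2^-1) (p0 s) dp)
    (is_derive_laplace nu b1 s0)) _.
  have := laplace_ode nu2 s0.
  have -> : p s `^ (nu + 2^-1) = p s * p s `^ (nu + 2^-1 - 1).
    by rewrite -powRD1// subrK.
  rewrite -/(p s); move: (laplace _ _ _) (laplace _ _ _) (powR _ _) => A B D e.
  rewrite (_ : p s * D * - B = - (p s * B * D)); last by ring.
  by rewrite e; field.
have Hc s t : 0 < s -> s <= t -> H t = H s.
  move=> s0 st.
  have dHs y : y \in `]s, t[ -> is_derive y 1 H 0.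
    by rewrite in_itv/= => /andP[sy _]; apply: dH; exact: lt_trans sy.
  have cH : {within `[s, t], continuous H}.
    apply: continuous_in_subspaceT => y /set_mem /=; rewrite in_itv/= => /andP[sy _].
    by apply: is_derive1_continuous; apply: dH; exact: lt_le_trans sy.
  have [c _ ] := MVT_segment st dHs cH.
  by rewrite mul0r => /eqP; rewrite subr_eq0 => /eqP.
have [t t0 lt] := laplace_gt0_near_infty nu2.
exists (H t); first by rewrite mulr_gt0 ?powR_gt0.
move=> s s0; have -> : H t = H s.
  by have [st|/ltW ts] := leP s t; [exact: Hc|exact/esym/Hc].
rewrite /H mulrAC -/(p s) powRN divff ?mul1r// gt_eqF ?powR_gt0//.
Qed.

Lemma cvg_at_right_id : s @[s --> (0 : R)^'+] --> (0 : R).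
Proof. exact: cvg_at_right_filter. Qed.

Lemma cvg_laplace_base nu : - 2^-1 < nu -> exists2 C : R, 0 < C &
  laplace (2 * nu) nu s @[s --> 0^'+] --> C.
Proof.
move=> nu2; have [C C0 hC] := laplace_closed_form nu2; exists C => //.
apply: (@cvg_trans _ (C * (1 + s ^+ 2) `^ (- (nu + 2^-1)) @[s --> 0^'+])).
  apply: near_eq_cvg; near=> s; apply/esym/hC.
  by near: s; exact: nbhs_right_gt.
rewrite -[X in _ `=>` nbhs X]mulr1; apply: cvgM; first exact: cvg_cst.
have p1 : 1 + s ^+ 2 @[s --> (0 : R)^'+] --> (1 : R).
  rewrite -[X in _ --> X]addr0; apply: cvgD; first exact: cvg_cst.
  rewrite -[X in _ --> X](mulr0 0); under eq_cvg do rewrite expr2.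
  by apply: cvgM; exact: cvg_at_right_id.
have /is_derive1_continuous c1 := is_derive1_powR (- (nu + 2^-1)) (@ltr01 R).
by have := cvg_comp _ _ p1 c1; rewrite powR1.
Unshelve. all: end_near. Qed.

Lemma cvg_laplace n nu : -1 < n%:R + 2 * nu -> exists2 l : R,
  laplace (n%:R + 2 * nu) nu s @[s --> 0^'+] --> l & (l == 0) = odd n.
Proof.
(* Two consecutive [m] are carried together, for all orders: [laplace_contiguous] takes [m + 2] at
   [mu] to [m] and [m + 1] at [mu + 1], and [(m + 2) + 2 mu = m + 2 (mu + 1)] preserves the
   hypothesis. *)
suff H m : forall mu, (-1 < m%:R + 2 * mu -> exists2 l : R,
    laplace (m%:R + 2 * mu) mu s @[s --> 0^'+] --> l & (l == 0) = odd m) /\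
  (-1 < m.+1%:R + 2 * mu -> exists2 l : R,
    laplace (m.+1%:R + 2 * mu) mu s @[s --> 0^'+] --> l & (l == 0) = odd m.+1).
  by move=> /(proj1 (H n nu)).
elim: m => [|m IH] mu.
  split; rewrite ?add0r => mu1.
    have [|C C0 hC] := @cvg_laplace_base mu; first by lra.
    by exists C => //; rewrite gt_eqF.
  have [|C C0 hC] := @cvg_laplace_base (mu + 1); first by lra.
  (* For exponent [1 + 2 mu] the coefficient in [laplace_contiguous] is zero, and what remains is
     [s] times a convergent transform. *)
  exists 0; last by rewrite eqxx.
  apply: (@cvg_trans _ (s * laplace (2 * (mu + 1)) (mu + 1) s @[s --> 0^'+])).
    apply: near_eq_cvg; near=> s; rewrite (laplace_contiguous mu mu1)//.
    rewrite (_ : 2 * mu + 1 - _ = 0) ?mul0r ?add0r; last by ring.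
    by rewrite (_ : 1 + 2 * mu + 1 = 2 * (mu + 1))//; ring.
  by rewrite -[X in _ `=>` nbhs X](mul0r C); apply: cvgM => //; exact: cvg_at_right_id.
split; first by move=> /(proj2 (IH mu)).
move=> mu1; have [IH0 IH1] := IH (mu + 1).
have e : m.+2%:R + 2 * mu = m%:R + 2 * (mu + 1) by rewrite -!natr1; ring.
have [|l0 L0 z0] := IH0; first by rewrite -e.
have [|l1 L1 _] := IH1; first by move: mu1; rewrite -!natr1; lra.
(* The limit is multiplied by a nonzero number, so vanishing depends only on the parity of the
   index. *)
exists (- m.+1%:R * l0); last by rewrite mulf_eq0 oppr_eq0 pnatr_eq0 z0/= negbK.
apply: (@cvg_trans _ (- m.+1%:R * laplace (m%:R + 2 * (mu + 1)) (mu + 1) s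
    + s * laplace (m.+1%:R + 2 * (mu + 1)) (mu + 1) s @[s --> 0^'+])).
  apply: near_eq_cvg; near=> s; rewrite (laplace_contiguous mu mu1)// -e.
  rewrite (_ : 2 * mu + 1 - _ = - m.+1%:R); last by rewrite -!natr1; ring.
  rewrite (_ : m.+2%:R + 2 * mu + 1 = m.+1%:R + 2 * (mu + 1))//.
  by rewrite -!natr1; ring.
rewrite -[X in _ `=>` nbhs X]addr0; apply: cvgD.
  by apply: cvgM => //; exact: cvg_cst.
by rewrite -[X in _ --> X](mul0r l1); apply: cvgM => //; exact: cvg_at_right_id.
Unshelve. all: end_near. Qed.

Definition bessel_moment n nu : R := lim (laplace (n%:R + 2 * nu) nu s @[s --> 0^'+]).

Lemma cvg_bessel_moment n nu : -1 < n%:R + 2 * nu ->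
  laplace (n%:R + 2 * nu) nu s @[s --> 0^'+] --> bessel_moment n nu.
Proof.
by move=> /cvg_laplace[l hl _]; apply: cvg_toP => //; apply/cvg_ex; exists l.
Qed.

Lemma bessel_moment_eq0 n nu : -1 < n%:R + 2 * nu ->
  (bessel_moment n nu == 0) = odd n.
Proof. by move=> /cvg_laplace[l hl <-]; rewrite /bessel_moment (cvg_lim _ hl). Qed.

(** [laplace_contiguous] raises the order and [laplace_ibp] brings it back to [nu]; the remaining
    terms are [s] times convergent transforms. *)
Lemma bessel_momentSS n nu : -1 < n%:R + 2 * nu -> bessel_moment n.+2 nu =
  - (n.+1%:R * (n.+1%:R + 2 * nu)) * bessel_moment n nu.
Proof.
move=> nu1.
have nu2 : -1 < n.+1%:R + 2 * nu by rewrite -natr1; lra.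
have nu3 : -1 < n.+2%:R + 2 * nu by rewrite -!natr1; lra.
have nu4 : -1 < n.+1%:R + 2 * (nu + 1) by rewrite -!natr1; lra.
apply/cvg_lim => //.
apply: (@cvg_trans _ (- (n.+1%:R * (n.+1%:R + 2 * nu)) * laplace (n%:R + 2 * nu) nu s
    + s * (n.+1%:R * laplace (n.+1%:R + 2 * nu) nu s +
           laplace (n.+1%:R + 2 * (nu + 1)) (nu + 1) s) @[s --> 0^'+])).
  apply: near_eq_cvg; near=> s.
  have s0 : 0 < s by near: s; exact: nbhs_right_gt.
  have := laplace_contiguous nu nu3 s0; have := laplace_ibp nu nu1 s0.
  rewrite (_ : n%:R + 2 * nu + 2 = n.+2%:R + 2 * nu); last by rewrite -!natr1; ring.
  rewrite (_ : n%:R + 2 * nu + 1 = n.+1%:R + 2 * nu); last by rewrite -!natr1; ring.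
  rewrite (_ : n.+2%:R + 2 * nu + 1 = n.+1%:R + 2 * (nu + 1)); last by rewrite -!natr1; ring.
  rewrite (_ : 2 * nu + 1 - _ = - n.+1%:R); last by rewrite -!natr1; ring.
  move: (laplace _ _ _) (laplace _ _ _) (laplace _ _ _) (laplace _ _ _) (laplace _ _ _) => A B D E F H1 ->.
  by rewrite (_ : E = (n.+1%:R + 2 * nu) * F - s * D); [ring|rewrite H1 addrK].
rewrite -[X in _ `=>` nbhs X]addr0; apply: cvgD.
  by apply: cvgM; [exact: cvg_cst|exact: cvg_bessel_moment].
rewrite -[X in _ `=>` nbhs X](mul0r (n.+1%:R * bessel_moment n.+1 nu + bessel_moment n.+1 (nu + 1))).
apply: cvgM; first exact: cvg_at_right_id.
apply: cvgD; last exact: cvg_bessel_moment.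
by apply: cvgM; [exact: cvg_cst|exact: cvg_bessel_moment].
Unshelve. all: end_near. Qed.

End laplace_bessel.

(** * Moments of modified Bessel functions of the second kind *)

Section hyperbolic.
Context {R : realType}.
Implicit Types (a nu t u x s : R).
Local Notation leb := (@lebesgue_measure R).
Local Notation "'Rp'" := (`]0%R, +oo[%classic : set R).

Definition sinhR t : R := (expR t - expR (- t)) / 2.

Lemma is_derive_expRN t : is_derive t 1 (fun t : R => expR (- t)) (- expR (- t)).
Proof.
have := is_derive1_expRl (- 1) t; rewrite !mulN1r.
by under [in X in is_derive _ _ X _ -> _]eq_fun do rewrite mulN1r.
Qed.

Lemma is_derive_coshR t : is_derive t 1 (@coshR R) (sinhR t).
Proof.
apply: is_derive_eq (is_derive1M (is_derive1D (is_derive_expR t) (is_derive_expRN t))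
  (is_derive1_cst 2^-1 t)) _.
by rewrite mulr0 addr0.
Qed.

Lemma is_derive_sinhR t : is_derive t 1 sinhR (coshR t).
Proof.
apply: is_derive_eq (is_derive1M (is_derive1B (is_derive_expR t) (is_derive_expRN t))
  (is_derive1_cst 2^-1 t)) _.
by rewrite mulr0 addr0 opprK.
Qed.

Lemma sinhR_sqr t : sinhR t * sinhR t = coshR t * coshR t - 1.
Proof.
rewrite /sinhR /coshR; have := expRxMexpNx_1 t.
move: (expR t) (expR (- t)) => A B AB.
transitivity ((A + B) / 2 * ((A + B) / 2) - A * B); last by rewrite AB.
by field.
Qed.

Lemma coshR_gt0 t : 0 < coshR t.
Proof. by rewrite divr_gt0// addr_gt0 ?expR_gt0. Qed.

Lemma norm_sinhR_le t : `|sinhR t| <= coshR t.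
Proof.
rewrite /sinhR /coshR ler_norml.
have := expR_gt0 t; have := expR_gt0 (- t).
by move: (expR t) (expR (- t)) => A B A0 B0; apply/andP; split; lra.
Qed.

Lemma coshR_ge_expR t : expR t / 2 <= coshR t.
Proof. by rewrite /coshR ler_wpM2r// lerDl expR_ge0. Qed.

Lemma coshR_le_expR t : coshR t <= expR `|t|.
Proof.
rewrite /coshR ler_pdivrMr// mulr_natr mulr2n lerD// ler_expR ?ler_norm//.
by rewrite -normrN ler_norm.
Qed.

Lemma powR_coshR_le a u : 0 <= a ->
  coshR u `^ (- a) <= 2 `^ a * expR (- (a * u)).
Proof.
move=> a0; have c0 := coshR_gt0 u.
have e0 : 0 < expR u / 2 by rewrite divr_gt0 ?expR_gt0.
have -> : 2 `^ a * expR (- (a * u)) = (expR u / 2) `^ (- a).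
  rewrite powRM ?expR_ge0 ?invr_ge0// -expRM -powR_inv1// -powRrM mulN1r opprK.
  by rewrite mulrC mulrN [u * a]mulrC.
rewrite !powRN lef_pV2 ?posrE ?powR_gt0//.
apply: ge0_ler_powR => //; rewrite ?nnegrE ?(ltW c0) ?(ltW e0)//.
exact: coshR_ge_expR.
Qed.

(* What is left of the integrand of [besselK] once [x] is integrated out. *)
Definition cosh_fun nu a u : R := coshR (nu * u) * coshR u `^ (- a).

Lemma cosh_fun_le nu a u : 0 <= a -> 0 < u ->
  `|cosh_fun nu a u| <= 2 `^ a * `|expR (- ((a - `|nu|) * u))|.
Proof.
move=> a0 u0; have cf0 : 0 <= cosh_fun nu a u by rewrite mulr_ge0 ?powR_ge0 ?(ltW (coshR_gt0 _)).
rewrite (ger0_norm cf0) (ger0_norm (expR_ge0 _)).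
rewrite mulrBl opprB expRD mulrCA.
apply: ler_pM; rewrite ?powR_ge0 ?(ltW (coshR_gt0 _))//; last exact: powR_coshR_le.
by rewrite (le_trans (coshR_le_expR _))// normrM (ger0_norm (ltW u0)).
Qed.

Lemma rapid_cosh_fun nu a : `|nu| < a -> rapid 0 (cosh_fun nu a).
Proof.
move=> nua; have a0 : 0 <= a by exact: le_trans (normr_ge0 nu) (ltW nua).
apply: (@rapid_le _ _ _ (fun u => expR (- ((a - `|nu|) * u)))).
  by move=> u; exact: cosh_fun_le.
by apply: rapid_expR; rewrite subr_gt0.
Qed.

Lemma is_derive_coshRZ nu u :
  is_derive u 1 (fun u => coshR (nu * u)) (nu * sinhR (nu * u)).
Proof.
apply: is_derive_eq (is_derive1_comp (is_derive_coshR _)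
  (is_derive1Z nu (is_derive1_id u))) _.
by rewrite mulr1 mulrC.
Qed.

Lemma is_derive_sinhRZ nu u :
  is_derive u 1 (fun u => sinhR (nu * u)) (nu * coshR (nu * u)).
Proof.
apply: is_derive_eq (is_derive1_comp (is_derive_sinhR _)
  (is_derive1Z nu (is_derive1_id u))) _.
by rewrite mulr1 mulrC.
Qed.

Lemma is_derive_powR_coshR a u : is_derive u 1 (fun u => coshR u `^ a)
  (a * coshR u `^ (a - 1) * sinhR u).
Proof. exact: is_derive1_powR_comp (coshR_gt0 u) (is_derive_coshR u). Qed.

Lemma continuous_cosh_fun nu a : continuous (cosh_fun nu a).
Proof.
move=> u.
have d := is_derive1M (is_derive_coshRZ nu u) (is_derive_powR_coshR (- a) u).
exact: (is_derive1_continuous d).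
Qed.

Definition cosh_int nu a : R := \int[leb]_(u in Rp) cosh_fun nu a u.

Lemma integrable_cosh_fun nu a : `|nu| < a ->
  leb.-integrable Rp (EFin \o cosh_fun nu a).
Proof.
move=> nua; apply: (@rapid_integrable _ 0) => //.
  by apply: measurable_continuous_half_line => u _; exact: continuous_cosh_fun.
exact: rapid_cosh_fun.
Qed.

Lemma cosh_intSS nu a : `|nu| < a ->
  a * (a + 1) * cosh_int nu (a + 2) = (a ^+ 2 - nu ^+ 2) * cosh_int nu a.
Proof.
move=> nua; have nua2 : `|nu| < a + 2 by lra.
have a0 : 0 < a by exact: le_lt_trans nua.
(* [F] is the Wronskian of [cosh (nu u)] and [cosh(u)^(-a)], so [F'] involves only their second
   derivatives, namely [nu^2 cosh (nu u)] and [a^2 cosh(u)^(-a) - a (a + 1) cosh(u)^(-a-2)]. *)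
pose F u := - a * (coshR (nu * u) * (coshR u `^ (- a - 1) * sinhR u))
  - nu * (sinhR (nu * u) * coshR u `^ (- a)).
pose f u := (a ^+ 2 - nu ^+ 2) * cosh_fun nu a u
  + - (a * (a + 1)) * cosh_fun nu (a + 2) u.
have dF (u : R) : is_derive u 1 F (f u).
  apply: is_derive_eq (is_derive1B
    (is_derive1Z (- a) (is_derive1M (is_derive_coshRZ nu u)
       (is_derive1M (is_derive_powR_coshR _ u) (is_derive_sinhR u))))
    (is_derive1Z nu (is_derive1M (is_derive_sinhRZ nu u)
       (is_derive_powR_coshR _ u)))) _.
  have c0 := coshR_gt0 u.
  rewrite /f /cosh_fun.
  have -> : - a - 1 = - (a + 2) + 1 by ring.
  have -> : - a = - (a + 2) + 1 + 1 by ring.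
  rewrite !addrK !powRD1//.
  have := sinhR_sqr u.
  move: (coshR (nu * u)) (sinhR (nu * u)) (coshR u) (sinhR u) (coshR u `^ _) => A B c s P.
  move=> H.
  have -> : (- (a + 2) + 1) * P * s * s = (- (a + 2) + 1) * P * (s * s) by ring.
  by rewrite H; ring.
(* Domination by [cosh_fun] gives only boundedness at the origin; [F] vanishes there because both of
   its terms contain a hyperbolic sine. *)
have F0 : F x @[x --> 0^'+] --> 0.
  have := is_derive1_continuous (dF 0) => /cvg_at_right_filter.
  by rewrite [F 0]/F mulr0 /sinhR oppr0 subrr mul0r !mulr0 mul0r mulr0 subr0.
have F1 : F x @[x --> +oo] --> 0.
  apply: (@rapid_cvgy _ 0) => //.
  apply: (@rapid_le _ _ (a + `|nu|) (cosh_fun nu a)); last exact: rapid_cosh_fun.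
  move=> u u0; have c0 := coshR_gt0 u; have d0 := coshR_gt0 (nu * u).
  rewrite (le_trans (ler_normB _ _))// mulrDl lerD//.
    rewrite normrM normrN (ger0_norm (ltW a0)) ler_wpM2l ?(ltW a0)//.
    rewrite normrM [in leRHS]/cosh_fun [leRHS]normrM ler_wpM2l//.
    rewrite -[- a in leRHS](subrK 1) powRD1// [leRHS]normrM [leLHS]normrM mulrC.
    by rewrite ler_wpM2r// [leRHS]ger0_norm ?(ltW c0)// norm_sinhR_le.
  rewrite normrM ler_wpM2l// [in leRHS]/cosh_fun [leRHS]normrM [leLHS]normrM.
  by rewrite ler_wpM2r// [leRHS]ger0_norm ?norm_sinhR_le// ltW.
have fi : leb.-integrable Rp (EFin \o f).
  by apply: half_line_integrableD; exact/half_line_integrableZ/integrable_cosh_fun.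
have cf x : 0 < x -> {for x, continuous f}.
  by move=> _; apply: continuousD;
    (apply: continuousM; [exact: cst_continuous|exact: continuous_cosh_fun]).
have := Rintegral_half_line_derive (fun x _ => dF x) cf F0 F1 fi.
rewrite half_line_RintegralD; try exact/half_line_integrableZ/integrable_cosh_fun.
rewrite !half_line_RintegralZ ?integrable_cosh_fun// -!/(cosh_int _ _).
by move: (cosh_int _ _) (cosh_int _ _) => A B H; lra.
Qed.

End hyperbolic.

(** * Integrals of powers against [e^(-c sqrt x)] *)

Section stretched_exponential.
Context {R : realType}.
Implicit Types (b c k u x : R) (g : R -> R).
Local Notation leb := (@lebesgue_measure R).
Local Notation "'Rp'" := (`]0%R, +oo[%classic : set R).

(** The factor [k] makes [x |-> k x] carry the exhaustion with [k = 1] onto this one, so that the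
    two limits in [ge0_integral_half_line_scale] are compared term by term. *)
Lemma cvg_integral_half_line_itvcy k g : 0 < k -> (forall x, 0 < x -> 0 <= g x) ->
  (forall x, 0 < x -> {for x, continuous g}) ->
  (\int[leb]_(x in `[(k * n.+1%:R^-1)%R, +oo[) (g x)%:E)%E @[n --> \oo] -->
  (\int[leb]_(x in Rp) (g x)%:E)%E.
Proof.
move=> k0 g0 cg.
pose A (n : nat) : set R := `[k * n.+1%:R^-1, +oo[%classic.
have Asub n : A n `<=` Rp.
  move=> x; rewrite /A /= !in_itv/= !andbT; apply: lt_le_trans.
  by rewrite mulr_gt0// invr_gt0.
have -> : Rp = \bigcup_n A n.
  apply/seteqP; split=> [x /half_lineP x0|x [n _ /Asub]//].
  have xk : 0 < x / k by rewrite divr_gt0.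
  have [N _ /(_ N (leqnn N)) /= Nx] := near_infty_natSinv_lt (PosNum xk).
  exists N => //; rewrite /A /= in_itv/= andbT mulrC -ler_pdivlMr// ltW//.
apply: ge0_nondecreasing_set_cvg_integral.
- move=> m n mn; apply/subsetPset => x; rewrite /A/= !in_itv/= !andbT.
  apply: le_trans; rewrite ler_wpM2l ?(ltW k0)// lef_pV2 ?posrE ?ltr0n//.
  by rewrite ler_nat.
- by move=> n; exact: measurable_itv.
- move=> n; apply/measurable_EFinP; apply: (@measurable_funS _ _ _ _ Rp) => //.
    exact: Asub.
  exact: measurable_continuous_half_line.
- by move=> n x /Asub /half_lineP /g0; rewrite lee_fin.
Qed.

(** The substitution is made on closed half-lines away from 0, where [g] is continuous up to the
    endpoint; the limit then allows a singularity of [g] at the origin. *)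
Lemma ge0_integral_half_line_scale k g : 0 < k -> (forall x, 0 < x -> 0 <= g x) ->
  (forall x, 0 < x -> {for x, continuous g}) ->
  (\int[leb]_(x in Rp) (g x)%:E = \int[leb]_(x in Rp) (k * g (k * x))%:E)%E.
Proof.
move=> k0 g0 cg.
pose h x := k * g (k * x).
have h0 x : 0 < x -> 0 <= h x.
  by move=> x0; rewrite mulr_ge0 ?(ltW k0)// g0// mulr_gt0.
have dk x := is_derive1Z k (is_derive1_id x).
have ch x : 0 < x -> {for x, continuous h}.
  move=> x0; apply: continuousM; first exact: cst_continuous.
  apply: (@continuous_comp _ _ _ (fun y => k * y) g).
    exact: is_derive1_continuous (dk x).
  by apply: cg; rewrite mulr_gt0.
have Lg := cvg_integral_half_line_itvcy k0 g0 cg.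
have Lh := cvg_integral_half_line_itvcy ltr01 h0 ch.
suff e n : (\int[leb]_(x in `[(k * n.+1%:R^-1)%R, +oo[) (g x)%:E =
    \int[leb]_(x in `[(1 * n.+1%:R^-1)%R, +oo[) (h x)%:E)%E.
  suff Lg' : (\int[leb]_(x in `[(1 * n.+1%:R^-1)%R, +oo[) (h x)%:E)%E
      @[n --> \oo] --> (\int[leb]_(x in Rp) (g x)%:E)%E.
    exact: (cvg_unique _ Lg' Lh).
  by under eq_cvg do rewrite -e.
set a : R := n.+1%:R^-1.
have a0 : 0 < a by rewrite invr_gt0.
have k1 : derive1 (fun y : R => k * y) = cst k.
  apply/funext => x; rewrite derive1E; have [_ ->] := dk x.
  by rewrite mulr1.
rewrite mul1r (@increasing_ge0_integration_by_substitutiony _ (fun x => k * x) g a).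
- apply: eq_integral => x _; rewrite k1 /h /= mulrC//.
- by move=> x y _ _ xy; rewrite ltr_pM2l.
- by rewrite k1 => x _; exact: cst_continuous.
- by rewrite k1; exact: is_cvg_cst.
- by rewrite k1; exact: is_cvg_cst.
- split; first by move=> x _; have [] := dk x.
  by apply: cvg_at_right_filter; exact: is_derive1_continuous (dk a).
- by apply: gt0_cvgMry => //; exact: cvg_cst.
- apply: continuous_in_subspaceT => x /set_mem /=; rewrite in_itv/= andbT => ax.
  by apply: cg; apply: lt_le_trans ax; rewrite mulr_gt0.
- move=> x; rewrite in_itv/= andbT => ax.
  by apply: g0; apply: lt_trans ax; rewrite mulr_gt0.
Qed.

Definition sqrtexp_fun b c x : R := x `^ b * expR (- (c * Num.sqrt x)).

Lemma rapid_sqrtexp_fun b c : 0 < c -> rapid b (sqrtexp_fun b c).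
Proof. by move=> c0; have := rapid_powR b (rapid_expR_sqrt c0); rewrite addr0. Qed.

Lemma is_derive_sqrtexp_fun b c x : 0 < x -> is_derive x 1 (sqrtexp_fun b c)
  (b * sqrtexp_fun (b - 1) c x + - (c / 2) * sqrtexp_fun (b - 2^-1) c x).
Proof.
move=> x0; have ds := is_derive1Z (- c) (is_derive1_sqrt x0).
have de := is_derive1_comp (is_derive_expR _) ds.
have := is_derive1M (is_derive1_powR b x0) de.
rewrite (_ : (fun y => _) = sqrtexp_fun b c); last first.
  by apply/funext => y; rewrite /sqrtexp_fun /= mulNr.
move=> /is_derive_eq; apply; rewrite /sqrtexp_fun /= mulNr.
have -> : x `^ b = Num.sqrt x * x `^ (b - 2^-1).
  by rewrite -powR12_sqrt ?ltW// -gt0_powRD// subrKC.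
have s0 : Num.sqrt x != 0 by rewrite gt_eqF// sqrtr_gt0.
rewrite -[Num.Def.sqrtr x]/(Num.sqrt x).
move: (Num.sqrt x) s0 (expR _) (x `^ _) (x `^ _) => s s0 e A B.
by field.
Qed.

Lemma continuous_sqrtexp_fun b c x : 0 < x -> {for x, continuous (sqrtexp_fun b c)}.
Proof. by move=> x0; exact: is_derive1_continuous (is_derive_sqrtexp_fun b c x0). Qed.

(** In closed form, [2 Gamma (2 b + 2)] for [b > -1]. *)
Definition sqrtexp_int b : R := \int[leb]_(x in Rp) sqrtexp_fun b 1 x.

Lemma integrable_sqrtexp_fun b : -1 < b ->
  leb.-integrable Rp (EFin \o sqrtexp_fun b 1).
Proof.
move=> b1; apply: (rapid_integrable b1); last exact: rapid_sqrtexp_fun.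
by apply: measurable_continuous_half_line => x; exact: continuous_sqrtexp_fun.
Qed.

(** The derivative of [x^(b+1) e^(-sqrt x)] integrates to zero; the exponent moves by [1/2] because
    [sqrt x] has derivative [x^(-1/2) / 2]. *)
Lemma sqrtexp_int_half b : -1 < b ->
  sqrtexp_int (b + 2^-1) = 2 * (b + 1) * sqrtexp_int b.
Proof.
move=> b1; have b2 : -1 < b + 2^-1 by lra.
pose f x := (b + 1) * sqrtexp_fun b 1 x + - (1 / 2) * sqrtexp_fun (b + 2^-1) 1 x.
have : \int[leb]_(x in Rp) f x = 0.
  apply: (@rapid_Rintegral_derive _ (b + 1) b (sqrtexp_fun (b + 1) 1)) => //.
  - move=> x x0; apply: is_derive_eq (is_derive_sqrtexp_fun _ _ x0) _.
    by rewrite addrK (_ : b + 1 - 2^-1 = b + 2^-1)//; field.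
  - move=> x x0; apply: continuousD;
      (apply: continuousM; [exact: cst_continuous|exact: continuous_sqrtexp_fun]).
  - lra.
  - exact: rapid_sqrtexp_fun.
  - apply: rapidD; apply: rapidZ; first exact: rapid_sqrtexp_fun.
    by apply: rapidW (rapid_sqrtexp_fun _ ltr01); rewrite lerDl.
rewrite half_line_RintegralD; try exact/half_line_integrableZ/integrable_sqrtexp_fun.
rewrite !half_line_RintegralZ ?integrable_sqrtexp_fun// -!/(sqrtexp_int _).
by move: (sqrtexp_int _) (sqrtexp_int _) => A B H; lra.
Qed.

Lemma sqrtexp_intS b : -1 < b ->
  sqrtexp_int (b + 1) = (2 * b + 2) * (2 * b + 3) * sqrtexp_int b.
Proof.
move=> b1; have b2 : -1 < b + 2^-1 by lra.
have -> : b + 1 = b + 2^-1 + 2^-1 by field.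
rewrite !sqrtexp_int_half//; move: (sqrtexp_int _) => A.
by field.
Qed.

Lemma integral_sqrtexp_fun b c : -1 < b -> 0 < c ->
  (\int[leb]_(x in Rp) (sqrtexp_fun b c x)%:E =
   (c `^ (- (2 * b + 2)) * sqrtexp_int b)%:E)%E.
Proof.
(* [sqrt (k x) = sqrt x / c], so this scaling normalises the exponential. *)
move=> b1 c0; pose k := c ^- 2.
have k0 : 0 < k by rewrite invr_gt0 exprn_gt0.
rewrite (ge0_integral_half_line_scale k0); last 2 first.
- by move=> x x0; rewrite mulr_ge0 ?powR_ge0 ?expR_ge0.
- by move=> x; exact: continuous_sqrtexp_fun.
have kE : k = c `^ (- 2) by rewrite powR_invn ?ltW.
have E x : 0 < x -> k * sqrtexp_fun b c (k * x) =
    c `^ (- (2 * b + 2)) * sqrtexp_fun b 1 x.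
  move=> x0; rewrite /sqrtexp_fun sqrtrM ?(ltW k0)// powRM ?(ltW k0) ?(ltW x0)//.
  have -> : Num.sqrt k = c^-1 by rewrite /k -exprVn sqrtr_sqr ger0_norm ?invr_ge0 ?ltW.
  rewrite mulVKf ?gt_eqF// mul1r kE -powRrM.
  rewrite (_ : - (2 * b + 2) = - 2 + - 2 * b) ?gt0_powRD//; last by ring.
  by rewrite !mulrA.
transitivity (\int[leb]_(x in Rp)
    ((c `^ (- (2 * b + 2)))%:E * (sqrtexp_fun b 1 x)%:E))%E.
  by apply: eq_integral => x /set_mem /half_lineP x0; rewrite E// EFinM.
rewrite integralZl//; last exact: integrable_sqrtexp_fun.
rewrite EFinM /sqrtexp_int /Rintegral fineK//.
exact: integrable_fin_num (integrable_sqrtexp_fun b1).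
Qed.

End stretched_exponential.

(** * Moments of [K_nu (sqrt x)] *)

Section besselK_moments.
Context {R : realType}.
Implicit Types (b c nu u x y : R).
Local Notation leb := (@lebesgue_measure R).
Local Notation "'Rp'" := (`]0%R, +oo[%classic : set R).

Definition besselK_fun nu y u : R := expR (- (y * coshR u)) * coshR (nu * u).

Lemma besselK_fun_gt0 nu y u : 0 < besselK_fun nu y u.
Proof. by rewrite mulr_gt0 ?expR_gt0 ?coshR_gt0. Qed.

Lemma continuous_coshR : continuous (@coshR R).
Proof. by move=> u; exact: is_derive1_continuous (is_derive_coshR u). Qed.

Lemma measurable_coshR : measurable_fun setT (@coshR R).
Proof. by apply: continuous_measurable_fun; exact: continuous_coshR. Qed.

Lemma integrable_besselK_fun nu y : 0 < y ->
  leb.-integrable Rp (EFin \o besselK_fun nu y).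
Proof.
move=> y0; apply: (@rapid_integrable _ 0); first exact: ltrN10.
  apply: measurable_funM.
    apply: measurableT_comp; first exact: measurable_expR.
    apply: measurable_funN; apply: measurable_funM => //.
    by apply: measurable_funTS; exact: measurable_coshR.
  apply: measurable_funTS; apply: measurableT_comp; first exact: measurable_coshR.
  exact: measurable_funM.
have nu1 : `|nu| < `|nu| + 1 by rewrite ltrDl.
(* Taken at [cosh u], this bounds [e^(-y cosh u)] by a multiple of [cosh(u)^(-(|nu| + 1))], a power
   large enough to beat [cosh (nu u)]. *)
have [C C0 hC] := powR_le_expR (`|nu| + 1) y0.
apply: (@rapid_le _ _ C _ _ _ (rapid_cosh_fun nu1)) => u u0.
have c0 := coshR_gt0 u; have d0 := coshR_gt0 (nu * u).
rewrite ger0_norm ?(ltW (besselK_fun_gt0 _ _ _))// /besselK_fun mulrC.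
rewrite ger0_norm; last by rewrite mulr_ge0 ?powR_ge0 ?ltW.
rewrite [in leRHS]/cosh_fun [leRHS]mulrCA ler_wpM2l ?(ltW d0)// expRN powRN.
rewrite -ler_pdivrMl// -invfM lef_pV2 ?posrE ?mulr_gt0 ?expR_gt0 ?powR_gt0//.
apply: le_trans (hC _ (ltW c0)).
by rewrite ge0_ler_powR ?nnegrE ?addr_ge0 ?(ltW c0) ?lerDr.
Qed.

Lemma besselKE nu y : 0 < y ->
  besselK nu y = \int[leb]_(u in Rp) besselK_fun nu y u.
Proof.
by move=> y0; rewrite /besselK -Rintegral_itv_obnd_cbnd//; exact: integrable_besselK_fun.
Qed.

Lemma besselK_gt0 nu y : 0 < y -> 0 < besselK nu y.
Proof.
move=> y0; rewrite besselKE//; apply: half_line_Rintegral_gt0.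
  exact: integrable_besselK_fun.
by move=> u _; exact: besselK_fun_gt0.
Qed.

Definition besselK_wfun nu b x : R := x `^ b * besselK nu (Num.sqrt x).

(** The indicators extend the integrand by zero from the quadrant to the plane, so that Tonelli's
    theorem applies to the full product. *)
Let tonelli_fun nu b (z : R * R) : \bar R :=
  (z.1 `^ b * besselK_fun nu (Num.sqrt z.1) z.2 * \1_Rp z.1 * \1_Rp z.2)%:E.

Let measurable_tonelli_fun nu b : measurable_fun setT (tonelli_fun nu b).
Proof.
have mfst : measurable_fun setT (fst : R * R -> R) by exact: measurable_fst.
have msnd : measurable_fun setT (snd : R * R -> R) by exact: measurable_snd.
apply/measurable_EFinP; apply: measurable_funM; last first.
  by apply: (measurableT_comp _ msnd); exact: measurable_indic.
apply: measurable_funM; last first.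
  by apply: (measurableT_comp _ mfst); exact: measurable_indic.
apply: measurable_funM; first exact: (measurableT_comp (measurable_powR b) mfst).
apply: measurable_funM.
  apply: measurableT_comp; first exact: measurable_expR.
  apply: measurable_funN; apply: measurable_funM.
    apply: (measurableT_comp _ mfst).
    by apply: continuous_measurable_fun; exact: sqrt_continuous.
  exact: (measurableT_comp measurable_coshR msnd).
apply: (measurableT_comp measurable_coshR).
exact: measurable_funM.
Qed.

Let tonelli_fun_ge0 nu b z : (0 <= tonelli_fun nu b z)%E.
Proof.
rewrite lee_fin; do 2 (apply: mulr_ge0; last by rewrite indicE).
by apply: mulr_ge0; [exact: powR_ge0|exact/ltW/besselK_fun_gt0].
Qed.

Let tonelli_F nu b x : (\int[leb]_u tonelli_fun nu b (x, u))%E =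
  ((EFin \o besselK_wfun nu b) \_ Rp) x.
Proof.
rewrite patchE; case: ifPn => [/set_mem /half_lineP x0|xn]; last first.
  rewrite integral0_eq// => u _.
  by rewrite /tonelli_fun/= indicE (negbTE xn) mulr0 mul0r.
have y0 : 0 < Num.sqrt x by rewrite sqrtr_gt0.
transitivity (\int[leb]_(u in Rp) ((x `^ b)%:E * (besselK_fun nu (Num.sqrt x) u)%:E))%E.
  rewrite [RHS]integral_mkcond; apply: eq_integral => u _.
  rewrite /tonelli_fun /= patchE !indicE mem_set; last exact/half_lineP.
  by rewrite mulr1; case: ifPn => _; rewrite ?mulr1 ?mulr0// EFinM.
rewrite integralZl//; last exact: integrable_besselK_fun.
rewrite /= /besselK_wfun besselKE// EFinM /Rintegral fineK//.
exact: integrable_fin_num (integrable_besselK_fun nu y0).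
Qed.

(** The integral in [x] is [integral_sqrtexp_fun] with [c = cosh u], whose factor [c^(-(2 b + 2))]
    joins [cosh (nu u)] to form [cosh_fun]. *)
Let tonelli_G nu b u : -1 < b -> (\int[leb]_x tonelli_fun nu b (x, u))%E =
  ((fun u => (sqrtexp_int b * cosh_fun nu (2 * b + 2) u)%:E) \_ Rp) u.
Proof.
move=> b1; rewrite patchE; case: ifPn => [/set_mem /half_lineP u0|un]; last first.
  by rewrite integral0_eq// => x _; rewrite /tonelli_fun/= [\1_ _ u]indicE (negbTE un) mulr0.
have c0 := coshR_gt0 u.
transitivity (\int[leb]_(x in Rp)
    ((coshR (nu * u))%:E * (sqrtexp_fun b (coshR u) x)%:E))%E.
  rewrite [RHS]integral_mkcond; apply: eq_integral => x _.
  rewrite /tonelli_fun /= patchE !indicE (mem_set (_ : Rp u)) ?mulr1; last exact/half_lineP.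
  case: ifPn => _; rewrite ?mulr1 ?mulr0//.
  rewrite -EFinM /sqrtexp_fun /besselK_fun [coshR u * _]mulrC; congr (_%:E).
  by rewrite [LHS]mulrA [LHS]mulrC.
rewrite ge0_integralZl//; last 3 first.
- apply/measurable_EFinP; apply: measurable_continuous_half_line => x.
  exact: continuous_sqrtexp_fun.
- by move=> x _; rewrite lee_fin mulr_ge0 ?powR_ge0 ?expR_ge0.
- by rewrite lee_fin ltW// coshR_gt0.
rewrite integral_sqrtexp_fun// -EFinM /cosh_fun; congr (_%:E).
by rewrite [RHS]mulrC [LHS]mulrA.
Qed.

Lemma besselK_exponent_gtN1 nu b : `|nu| < 2 * b + 2 -> -1 < b.
Proof. by move=> H; have := normr_ge0 nu; lra. Qed.

(** [|nu| < 2 b + 2] is the convergence condition of the integral in [u]; it implies [-1 < b], that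
    of the integral in [x]. *)
Lemma integral_besselK_wfun nu b : `|nu| < 2 * b + 2 ->
  (\int[leb]_(x in Rp) (besselK_wfun nu b x)%:E =
   (sqrtexp_int b * cosh_int nu (2 * b + 2))%:E)%E.
Proof.
move=> nub; have b1 := besselK_exponent_gtN1 nub.
transitivity (\int[leb]_x \int[leb]_u tonelli_fun nu b (x, u))%E.
  by rewrite [LHS]integral_mkcond; apply: eq_integral => x _; rewrite tonelli_F.
rewrite (@fubini_tonelli _ _ _ _ _ leb leb (tonelli_fun nu b))//; last first.
  exact: measurable_tonelli_fun.
transitivity (\int[leb]_(u in Rp) ((sqrtexp_int b)%:E * (cosh_fun nu (2 * b + 2) u)%:E))%E.
  rewrite [RHS]integral_mkcond; apply: eq_integral => u _; rewrite tonelli_G//.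
rewrite integralZl//; last exact: integrable_cosh_fun.
rewrite EFinM; congr (_ * _)%E; rewrite /cosh_int /Rintegral fineK//.
exact: integrable_fin_num (integrable_cosh_fun nub).
Qed.

(** Measurability comes from Tonelli's theorem, the function being the marginal of a jointly
    measurable nonnegative one. *)
Lemma measurable_besselK_wfun nu b : measurable_fun Rp (besselK_wfun nu b).
Proof.
apply/measurable_EFinP; apply/(measurable_restrictT _ measurable_half_line).
rewrite (_ : _ \_ _ = (fun x => \int[leb]_u tonelli_fun nu b (x, u))%E).
  apply: (@measurable_fun_fubini_tonelli_F _ _ _ _ _ leb (tonelli_fun nu b)) => //.
  exact: measurable_tonelli_fun.
by apply/funext => x; rewrite tonelli_F.
Qed.

Lemma besselK_wfun_gt0 nu b x : 0 < x -> 0 < besselK_wfun nu b x.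
Proof. by move=> x0; rewrite mulr_gt0 ?powR_gt0// besselK_gt0// sqrtr_gt0. Qed.

Lemma integrable_besselK_wfun nu b : `|nu| < 2 * b + 2 ->
  leb.-integrable Rp (EFin \o besselK_wfun nu b).
Proof.
move=> nub; apply: ge0_integrable; first exact: measurable_half_line.
- exact: measurable_besselK_wfun.
- by move=> x /half_lineP /(besselK_wfun_gt0 nu b) /ltW.
- by rewrite integral_besselK_wfun// ltry.
Qed.

Definition besselK_moment nu b : R := \int[leb]_(x in Rp) besselK_wfun nu b x.

(** The factor [(2 b + 2) (2 b + 3)] of [sqrtexp_intS] is the [a (a + 1)] of [cosh_intSS] at
    [a = 2 b + 2], so it cancels between the two recurrences. *)
Lemma besselK_momentS nu b : `|nu| < 2 * b + 2 ->
  besselK_moment nu (b + 1) = ((2 * b + 2) ^+ 2 - nu ^+ 2) * besselK_moment nu b.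
Proof.
move=> nub; have b1 := besselK_exponent_gtN1 nub.
have nub2 : `|nu| < 2 * (b + 1) + 2 by lra.
rewrite /besselK_moment /Rintegral !integral_besselK_wfun//= sqrtexp_intS//.
have := cosh_intSS nub.
have -> : 2 * (b + 1) + 2 = 2 * b + 2 + 2 by ring.
have -> : 2 * b + 2 + 1 = 2 * b + 3 by ring.
move: (sqrtexp_int b) (cosh_int _ _) (cosh_int _ _) => A B D H.
by rewrite [LHS]mulrAC H; ring.
Qed.

End besselK_moments.

(** * Polynomials orthogonal for a moment functional *)

Section moment_functionals.
Context {R : fieldType}.
Implicit Types (m : nat -> R) (p q r : {poly R}).

Definition polymom m p : R := \sum_(i < size p) p`_i * m i.

Lemma polymomE m n p : (size p <= n)%N -> polymom m p = \sum_(i < n) p`_i * m i.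
Proof.
move=> pn; rewrite /polymom (big_ord_widen n (fun i => p`_i * m i))// big_mkcond/=.
apply: eq_bigr => i _; case: ifPn => //; rewrite -leqNgt => pi.
by rewrite nth_default// mul0r.
Qed.

Fact polymom_is_linear m : linear_for *%R (polymom m).
Proof.
move=> a p q; pose n := maxn (size p) (size q).
have pqn : (size (a *: p + q)%R <= n)%N.
  rewrite (leq_trans (size_polyD _ _))// geq_max leq_maxr andbT.
  by rewrite (leq_trans (size_scale_leq _ _))// leq_maxl.
rewrite (polymomE _ pqn) (polymomE _ (leq_maxl _ _ : size p <= n)%N).
rewrite (polymomE _ (leq_maxr _ _ : size q <= n)%N) mulr_sumr -big_split/=.
by apply: eq_bigr => i _; rewrite coefD coefZ mulrDl mulrA.
Qed.

HB.instance Definition _ m := GRing.isLinear.Build R {poly R} R *%R (polymom m)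
  (polymom_is_linear m).

Lemma polymomXn m k : polymom m 'X^k = m k.
Proof.
rewrite /polymom size_polyXn big_ord_recr/= coefXn eqxx mul1r big1 ?add0r//.
by move=> i _; rewrite coefXn ltn_eqF ?mul0r.
Qed.

Definition nsq r : {poly R} := r \Po (- 'X^2).

Lemma size_nX2 : size (- 'X^2 : {poly R}) = 3.
Proof. by rewrite size_polyN size_polyXn. Qed.

Lemma nsqM p q : nsq (p * q) = nsq p * nsq q.
Proof. exact: comp_polyM. Qed.

Lemma nsqX : nsq 'X = - 'X^2.
Proof. exact: comp_polyX. Qed.

Lemma nsqXn i : nsq 'X^i = (-1) ^+ i *: 'X^(2 * i).
Proof.
by rewrite /nsq comp_Xn_poly -scaleN1r exprZn -exprM.
Qed.

Lemma nsq_eq0 p : (nsq p == 0) = (p == 0).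
Proof. by rewrite /nsq comp_poly_eq0// size_nX2. Qed.

Lemma size_nsq p : p != 0 -> size (nsq p) = ((size p).-1 * 2).+1.
Proof.
move=> p0; have : (0 < size (nsq p))%N by rewrite size_poly_gt0 nsq_eq0.
by move=> /prednK <-; rewrite size_comp_poly size_nX2.
Qed.

Lemma nsq_coefE p : nsq p = \sum_(i < size p) p`_i *: nsq 'X^i.
Proof.
rewrite -{1}[p]coefK poly_def /nsq raddf_sum/=.
by apply: eq_bigr => i _; rewrite comp_polyZ.
Qed.

Lemma lead_coef_nsq p : lead_coef (nsq p) = lead_coef p * (-1) ^+ (size p).-1.
Proof. by rewrite /nsq lead_coef_comp ?size_nX2// lead_coefN lead_coefXn. Qed.

Lemma nsq_split p : exists E U : {poly R}, p = nsq E + 'X * nsq U.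
Proof.
(* Composition with [- 'X] undoes the sign of [- 'X^2] in [nsq]. *)
exists (even_poly p \Po - 'X), (odd_poly p \Po - 'X).
have e : (- 'X : {poly R}) \Po - 'X^2 = 'X^2.
  by rewrite raddfN/= comp_polyX opprK.
by rewrite /nsq -!comp_polyA !e mulrC -[LHS]poly_even_odd.
Qed.

(** Nonzero summands have sizes of opposite parity, so their leading terms cannot cancel. *)
Lemma size_nsq_split E U : size (nsq E + 'X * nsq U) =
  maxn (size (nsq E)) (size ('X * nsq U)).
Proof.
have [->|E0] := eqVneq E 0; first by rewrite /nsq comp_poly0 add0r size_poly0 max0n.
have [->|U0] := eqVneq U 0.
  by rewrite /nsq comp_poly0 mulr0 addr0 size_poly0 maxn0.
have sE := size_nsq E0.
have sU : size ('X * nsq U) = ((size U).-1 * 2).+2.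
  by rewrite mulrC size_mulX ?size_nsq// nsq_eq0.
have : size (nsq E) != size ('X * nsq U).
  rewrite sE sU; apply/eqP => /(congr1 odd) /=.
  by rewrite !muln2 !odd_double.
case: ltngtP => // H _.
- by rewrite addrC size_polyDl.
- by rewrite size_polyDl.
Qed.

End moment_functionals.

(** * Linear algebra for the functionals [L] of the weight and [B] of [x^mu J_nu] *)

Section orthogonality.
Context {R : realFieldType}.
Implicit Types (p q r : {poly R}).
Variables (L B : {scalar {poly R}}) (phi : nat -> {poly R}) (kappa : R).
Hypothesis phi_monic : forall n, phi n \is monic.
Hypothesis size_phi : forall n, size (phi n) = n.+1.
Hypothesis phi_orth : forall n m, n != m -> L (phi n * phi m) = 0.
Hypothesis L_sqr : forall p, p != 0 -> L (p * p) != 0.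
Hypothesis L_Xsqr : forall p, p != 0 -> L ('X * (p * p)) != 0.
Hypothesis kappa_neq0 : kappa != 0.

(** Induction on the size of [q]: with [m] its degree, subtracting [lead_coef q *: phi m] lowers the
    size, and [phi m] is orthogonal to [phi n] because [m < n]. *)
Lemma phi_orth_small n q : (size q <= n)%N -> L (phi n * q) = 0.
Proof.
have [k] := ubnP (size q); elim: k q => // k IH q; rewrite ltnS => qk qn.
have [->|q0] := eqVneq q 0; first by rewrite mulr0 raddf0.
have s0 : (0 < size q)%N by rewrite size_poly_gt0.
pose m := (size q).-1; have sq : size q = m.+1 by rewrite prednK.
pose r := q - lead_coef q *: phi m.
have rm : (size r <= m)%N.
  apply/leq_sizeP => j; rewrite leq_eqVlt => /predU1P[<-|mj].
    rewrite coefB coefZ /lead_coef.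
    have := phi_monic m; rewrite monicE /lead_coef size_phi /= => /eqP ->.
    by rewrite mulr1 subrr.
  by rewrite coefB coefZ !nth_default ?mulr0 ?subrr ?sq ?size_phi.
have -> : q = r + lead_coef q *: phi m by rewrite subrK.
rewrite mulrDr linearD/= -scalerAr linearZ/= phi_orth ?mulr0 ?addr0; last first.
  by rewrite gtn_eqF// -sq.
have mn : (m < n)%N by rewrite -sq.
by apply: IH; [rewrite (leq_ltn_trans rm)// -sq | rewrite (leq_trans rm)// ltnW].
Qed.

(** If [phi n = q * 'X], then [q] has size [n] and [L ('X * (q * q)) = L (phi n * q) = 0], against
    [L_Xsqr]. *)
Lemma phi0_neq0 n : (phi n).[0] != 0.
Proof.
apply/eqP => /eqP; rewrite -[_ == 0]/(root _ _) => /factor_theorem[q].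
rewrite subr0 => e.
have q0 : q != 0.
  apply/eqP => q0; have := size_phi n; by rewrite e q0 mul0r size_poly0.
have sq : size q = n.
  by have := size_phi n; rewrite e size_mulX// => -[].
have := L_Xsqr q0; rewrite mulrA [_ * q]mulrC mulrA mulrC mulrCA -e mulrC.
by rewrite phi_orth_small ?sq// eqxx.
Qed.

Definition bessel_orth n q := forall k, (k < n)%N -> B (q * 'X^k) = 0.

Lemma bessel_orth_test n q r : bessel_orth n q -> (size r <= n)%N -> B (q * r) = 0.
Proof.
move=> qn rn; rewrite -[r]coefK poly_def mulr_sumr linear_sum big1//= => i _.
by rewrite -scalerAr linearZ/= qn ?mulr0// (leq_trans (ltn_ord i)).
Qed.

Lemma phi_nsq_size n : size (nsq (phi n)) = (2 * n).+1.
Proof.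
rewrite size_nsq; first by rewrite size_phi/= mulnC.
by rewrite -size_poly_eq0 size_phi.
Qed.

Definition even_sol n : {poly R} := (-1) ^+ n *: nsq (phi n).

Lemma even_sol_monic n : even_sol n \is monic /\ size (even_sol n) = (2 * n).+1.
Proof.
split; last by rewrite size_scale ?signr_eq0// phi_nsq_size.
rewrite monicE lead_coefZ lead_coef_nsq size_phi (eqP (phi_monic n)) mul1r.
by rewrite -expr2 sqrr_sign.
Qed.

Lemma even_solE n x : (even_sol n).[x] = (-1) ^+ n * (phi n).[- x ^+ 2].
Proof. by rewrite /even_sol hornerZ horner_comp hornerN hornerXn. Qed.

(** Brings the test monomials to the two forms on which [B] is known; the sign compensates the one
    in [nsqXn]. *)
Lemma Xn_nsq k : 'X^k =
  (-1) ^+ k./2 *: ((if odd k then 'X else 1) * nsq 'X^(k./2)) :> {poly R}.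
Proof.
rewrite nsqXn scalerAr scalerA -expr2 sqrr_sign scale1r.
rewrite -{1}[k]odd_double_half exprD mul2n; case: (odd k) => //.
Qed.

Lemma phi_orth_Xn n k : (k < n)%N -> L (phi n * 'X^k) = 0.
Proof. by move=> kn; rewrite phi_orth_small// size_polyXn. Qed.

Section even_functional.
Hypothesis B_nsq : forall r, B (nsq r) = kappa * L r.
Hypothesis B_Xnsq : forall r, B ('X * nsq r) = 0.

Lemma even_even_orth n : bessel_orth (2 * n) (even_sol n).
Proof.
move=> k kn; rewrite Xn_nsq -scalerAl -scalerAr !linearZ/=.
have kn2 : (k./2 < n)%N by rewrite ltn_half_double -mul2n.
case: (odd k); first by rewrite [_ * ('X * _)]mulrCA -nsqM B_Xnsq !mulr0.
by rewrite mul1r -nsqM B_nsq phi_orth_Xn ?mulr0.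
Qed.

(** The polynomial is tested against its own parts: [nsq E] gives [kappa * L (E * E) = 0], and
    ['X * nsq U] gives [- (kappa * L ('X * (U * U))) = 0]. *)
Lemma even_unique n q : (size q <= n)%N -> bessel_orth n q -> q = 0.
Proof.
have [E [U ->]] := nsq_split q; rewrite size_nsq_split geq_max => /andP[sE sU] qn.
have E0 : E = 0.
  apply/eqP; apply: contraT => E0; have := bessel_orth_test qn sE.
  rewrite mulrDl -mulrA -!nsqM raddfD/= B_nsq B_Xnsq addr0 => /eqP.
  by rewrite mulf_eq0 (negbTE kappa_neq0) (negbTE (L_sqr E0)).
have U0 : U = 0.
  apply/eqP; apply: contraT => U0; have := bessel_orth_test qn sU.
  rewrite E0 [nsq 0]comp_poly0 add0r.
  have -> : 'X * nsq U * ('X * nsq U) = - nsq ('X * (U * U)).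
    by rewrite !nsqM nsqX; ring.
  rewrite raddfN/= B_nsq => /eqP; rewrite oppr_eq0.
  by rewrite mulf_eq0 (negbTE kappa_neq0) (negbTE (L_Xsqr U0)).
by rewrite E0 U0 /nsq !comp_poly0 mulr0 addr0.
Qed.

(** The constant makes the combination vanish at 0, hence divisible by ['X]. The quotient is the
    monic orthogonal polynomial of degree [n] for [p |-> L ('X * p)], the Christoffel transform of
    [L]. *)
Lemma christoffel_quotient n : exists2 chi : {poly R},
  'X * chi = phi n.+1 - ((phi n.+1).[0] / (phi n).[0]) *: phi n &
  chi \is monic /\ size chi = n.+1.
Proof.
set c := _ / _; set psi := _ - _.
have : root psi 0.
  by rewrite /root /psi !hornerE /c divfK ?subrr// phi0_neq0.
move=> /factor_theorem[chi]; rewrite subr0 => e.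
have spsi : size psi = n.+2.
  rewrite size_polyDl size_phi// size_polyN (leq_ltn_trans (size_scale_leq _ _))//.
  by rewrite size_phi.
have lpsi : psi \is monic.
  rewrite monicE lead_coefDl ?(eqP (phi_monic _))// size_polyN size_phi.
  by rewrite (leq_ltn_trans (size_scale_leq _ _))// size_phi.
have chi0 : chi != 0.
  by apply/eqP => chi0; move: spsi; rewrite e chi0 mul0r size_poly0.
exists chi; first by rewrite e mulrC.
split; first by move: lpsi; rewrite e monicMr ?monicX.
by move: spsi; rewrite e size_mulX// => -[].
Qed.

Lemma even_odd_sol n : exists q : {poly R}, [/\ q \is monic, size q = (2 * n + 1).+1,
  bessel_orth (2 * n + 1) q &
  forall x, x != 0 -> q.[x] = (-1) ^+ n.+1 / x * ((phi n.+1).[- x ^+ 2]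
    - (phi n.+1).[0] / (phi n).[0] * (phi n).[- x ^+ 2])].
Proof.
have [chi e [mchi schi]] := christoffel_quotient n.
have chi0 : chi != 0 by rewrite monic_neq0.
(* The sign makes the polynomial monic. The combination of [phi n.+1] and [phi n] takes at [- x^2]
   the value [- x^2 chi(- x^2)], so recovering [x chi(- x^2)] divides by [- x], whence the sign
   exponent [n + 1]. *)
exists ((-1) ^+ n *: ('X * nsq chi)); split.
- rewrite monicE lead_coefZ lead_coefM lead_coefX mul1r lead_coef_nsq schi.
  by rewrite (eqP mchi) mul1r -expr2 sqrr_sign.
- rewrite size_scale ?signr_eq0// mulrC size_mulX ?nsq_eq0//.
  by rewrite size_nsq// schi/= addn1 mulnC.
- move=> k kn; rewrite Xn_nsq -scalerAl -scalerAr !linearZ/=.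
  case: (boolP (odd k)) => ok; last by rewrite mul1r -mulrA -nsqM B_Xnsq !mulr0.
  (* As ['X * 'X = - nsq 'X], the product of two odd factors brings the extra ['X] into [L]. *)
  have -> : 'X * nsq chi * ('X * nsq 'X^(k./2)) = - nsq ('X * chi * 'X^(k./2)).
    by rewrite !nsqM nsqX; ring.
  have kn2 : (k./2 < n)%N.
    move: kn; rewrite -{1}[k]odd_double_half ok add1n addn1 ltnS -mul2n.
    by rewrite ltn_pmul2l.
  have L0 : L ('X * chi * 'X^(k./2)) = 0.
    rewrite e mulrBl raddfB/= -scalerAl linearZ/=.
    by rewrite (phi_orth_Xn kn2) (phi_orth_Xn (leqW kn2)) mulr0 subrr.
  by rewrite raddfN/= B_nsq L0 mulr0 oppr0 !mulr0.
- move=> x x0; have := congr1 (horner^~ (- x ^+ 2)) e.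
  rewrite hornerD hornerN hornerZ hornerM hornerX => <-.
  rewrite hornerZ hornerM hornerX horner_comp hornerN hornerXn.
  rewrite [(-1) ^+ n.+1]exprS.
  by move: (chi.[_]) => c; field.
Qed.

End even_functional.

Section odd_functional.
Hypothesis B_nsq : forall r, B (nsq r) = 0.
Hypothesis B_Xnsq : forall r, B ('X * nsq r) = kappa * L r.

Lemma odd_even_orth n : bessel_orth (2 * n) (even_sol n).
Proof.
move=> k kn; rewrite Xn_nsq -scalerAl -scalerAr !linearZ/=.
have kn2 : (k./2 < n)%N by rewrite ltn_half_double -mul2n.
case: (odd k); last by rewrite mul1r -nsqM B_nsq !mulr0.
by rewrite [_ * ('X * _)]mulrCA -nsqM B_Xnsq phi_orth_Xn ?mulr0.
Qed.

(** Testing [q] against [nsq U] kills the even part and leaves [kappa * L (U * U)]. *)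
Lemma odd_part_eq0 n E U : let q := nsq E + 'X * nsq U in
  bessel_orth n q -> (size (nsq U) <= n)%N -> U = 0.
Proof.
move=> q qn sU; apply/eqP; apply: contraT => U0.
have := bessel_orth_test qn sU.
rewrite mulrDl -mulrA -!nsqM raddfD/= B_nsq B_Xnsq add0r => /eqP.
by rewrite mulf_eq0 (negbTE kappa_neq0) (negbTE (L_sqr U0)).
Qed.

Lemma odd_unique n q : (size q <= 2 * n)%N -> bessel_orth (2 * n) q -> q = 0.
Proof.
have [E [U ->]] := nsq_split q; rewrite size_nsq_split geq_max => /andP[sE sU] qn.
have U0 : U = 0.
  have [//|U0] := eqVneq U 0.
  apply: (odd_part_eq0 qn); apply: leq_trans sU.
  by rewrite mulrC size_mulX ?nsq_eq0.
move: qn; rewrite U0 /nsq comp_poly0 mulr0 addr0 -/(nsq E) => qn.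
have [->|E0] := eqVneq E 0; first by rewrite /nsq comp_poly0.
(* [nsq E] has odd size, so a size of at most [2 n] is strictly smaller and leaves room for the
   factor ['X]. The evenness of the bound is essential here. *)
have sXE : (size ('X * nsq E)%R <= 2 * n)%N.
  rewrite mulrC size_mulX ?nsq_eq0//.
  move: sE; rewrite size_nsq// [((size E).-1 * 2)%N]mulnC !mul2n.
  by rewrite leq_eqVlt => /predU1P[/(congr1 odd)|//]; rewrite /= !odd_double.
have := bessel_orth_test qn sXE; rewrite mulrCA -nsqM B_Xnsq => /eqP.
by rewrite mulf_eq0 (negbTE kappa_neq0) (negbTE (L_sqr E0)).
Qed.

(** The conditions suffice to test against [nsq U], so the odd part vanishes; then [q = nsq E] would
    be zero or of odd size, against the size [2 n + 2]. *)
Lemma odd_no_sol n q : size q = (2 * n + 1).+1 -> ~ bessel_orth (2 * n + 1) q.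
Proof.
have [E [U ->]] := nsq_split q => sq qn.
have sU : (size (nsq U) <= 2 * n + 1)%N.
  have [->|U0] := eqVneq U 0; first by rewrite /nsq comp_poly0 size_poly0.
  rewrite -ltnS -[leqRHS]sq size_nsq_split leq_max mulrC size_mulX ?nsq_eq0//.
  by rewrite leqnn orbT.
have U0 := odd_part_eq0 qn sU.
move: sq; rewrite U0 /nsq comp_poly0 mulr0 addr0 -/(nsq E).
have [->|E0] := eqVneq E 0; first by rewrite /nsq comp_poly0 size_poly0.
rewrite size_nsq// => /(congr1 odd).
by rewrite /= muln2 addn1 mul2n /= !odd_double.
Qed.

End odd_functional.
End orthogonality.

(** * Comparison of the two moment functionals *)

Section polynomial_integrals.
Context {R : realType}.
Implicit Types (g : R -> R) (p : {poly R}).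
Local Notation leb := (@lebesgue_measure R).
Local Notation "'Rp'" := (`]0%R, +oo[%classic : set R).

Lemma half_line_Rintegral_sum (f : nat -> R -> R) (c : nat -> R) n :
  (forall i, leb.-integrable Rp (EFin \o f i)) ->
  leb.-integrable Rp (EFin \o (fun x => \sum_(i < n) c i * f i x)) /\
  \int[leb]_(x in Rp) (\sum_(i < n) c i * f i x) =
    \sum_(i < n) c i * \int[leb]_(x in Rp) f i x.
Proof.
move=> fi; elim: n => [|n [IH1 IH2]].
  split; last first.
    rewrite big_ord0 (half_line_Rintegral_eq (g := cst 0)) ?Rintegral_cst ?mul0r//.
    by move=> x _; rewrite big_ord0.
  apply: (half_line_integrable_eq (f := fun x => 0 * f 0%N x)).
    by move=> x _; rewrite big_ord0 mul0r.
  exact: half_line_integrableZ.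
have cn := half_line_integrableZ (c n) (fi n).
have e x : \sum_(i < n.+1) c i * f i x = \sum_(i < n) c i * f i x + c n * f n x.
  by rewrite big_ord_recr.
split.
  apply: half_line_integrable_eq (half_line_integrableD IH1 cn) => x _.
  by rewrite e.
rewrite (half_line_Rintegral_eq (fun x _ => e x)) half_line_RintegralD//.
by rewrite half_line_RintegralZ// IH2 big_ord_recr.
Qed.

Lemma half_line_Rintegral_poly g p :
  (forall j, leb.-integrable Rp (EFin \o (fun x => g x * x ^+ j))) ->
  leb.-integrable Rp (EFin \o (fun x => g x * p.[x])) /\
  \int[leb]_(x in Rp) (g x * p.[x]) =
    polymom (fun j => \int[leb]_(x in Rp) (g x * x ^+ j)) p.
Proof.
move=> gi; have [H1 H2] := half_line_Rintegral_sum (fun i => p`_i) (size p) gi.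
have e x : \sum_(i < size p) p`_i * (g x * x ^+ i) = g x * p.[x].
  by rewrite horner_coef mulr_sumr; apply: eq_bigr => i _; rewrite mulrCA.
split; first by apply: half_line_integrable_eq H1 => x _; exact: e.
by rewrite /polymom -H2; apply: half_line_Rintegral_eq => x _; rewrite e.
Qed.

(** Nonnegative roots are divided out one at a time. The resulting half-line is the set of positive
    measure on which a nonnegative polynomial is strictly positive. *)
Lemma poly_eventually_neq0 p : p != 0 -> exists2 a, 0 <= a &
  forall x, a < x -> p.[x] != 0.
Proof.
have [n] := ubnP (size p); elim: n p => // n IH p; rewrite ltnS => pn p0.
have [[x [x0 px]]|nex] := pselect (exists x, 0 <= x /\ p.[x] = 0); last first.
  exists 0 => // x x0; apply/eqP => px; apply: nex; exists x; split => //.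
  exact: ltW.
have /factor_theorem[q e] : root p x by apply/eqP.
have q0 : q != 0 by apply: contra_neq p0 => q0; rewrite e q0 mul0r.
have sq : (size q < n)%N.
  rewrite (leq_trans _ pn)// e size_Mmonic ?monicXsubC// size_XsubC addn2/=.
  by rewrite ltnS leqnn.
have [a a0 aq] := IH q sq q0.
exists (Num.max a x); first by rewrite le_max a0.
move=> y; rewrite gt_max => /andP[ay xy].
rewrite e hornerM mulf_neq0 ?aq// hornerXsubC subr_eq0 gt_eqF//.
Qed.

Lemma half_line_Rintegral_poly_gt0 g p :
  (forall x, 0 < x -> 0 < g x) -> p != 0 -> (forall x, 0 < x -> 0 <= p.[x]) ->
  leb.-integrable Rp (EFin \o (fun x => g x * p.[x])) ->
  0 < \int[leb]_(x in Rp) (g x * p.[x]).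
Proof.
move=> g0 p0 pge0 gpi; have [a a0 ap] := poly_eventually_neq0 p0.
apply: (@Rintegral_gt0 _ Rp `]a, +oo[%classic) => //.
- by move=> x /=; rewrite !in_itv/= !andbT; exact: le_lt_trans.
- by rewrite lebesgue_measure_itv/= ltry addye ?ltry.
- by move=> x /half_lineP x0; rewrite mulr_ge0 ?pge0// ltW// g0.
- move=> x /=; rewrite in_itv/= andbT => ax.
  have x0 : 0 < x by exact: le_lt_trans ax.
  by rewrite mulr_gt0 ?g0// lt_neqAle eq_sym ap//= pge0.
Qed.

(** Turns the orthogonality of the [phi n], stated with Abel limits, into plain integrals. The limit
    is assumed to exist, so the sequence [s = 1 / (n + 2)] identifies it, by dominated
    convergence. *)
Lemma abel_limit_integrable g (l : R) : leb.-integrable Rp (EFin \o g) ->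
  (\int[leb]_(x in Rp) (g x * expR (- (s * x)))) @[s --> 0^'+] --> l ->
  \int[leb]_(x in Rp) g x = l.
Proof.
move=> gi hl.
pose F s := \int[leb]_(x in Rp) (g x * expR (- (s * x))).
have H1 : F n.+2%:R^-1 @[n --> \oo] --> l by exact: (cvg_exhaust_left hl).
have mg : measurable_fun Rp g by apply/measurable_EFinP; exact: measurable_int gi.
have H2 : (\int[leb]_(x in Rp) (g x * expR (- (n.+2%:R^-1 * x)))%:E)%E @[n --> \oo] -->
    (\int[leb]_(x in Rp) (g x)%:E)%E.
  apply: (@dominated_cvg _ _ _ leb _ _
    (fun n x => (g x * expR (- (n.+2%:R^-1 * x)))%:E) _ (fun x => `|(g x)%:E|%E)) => //.
  - move=> n; apply/measurable_EFinP; apply: measurable_funM => //.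
    apply: measurable_funTS; apply: measurableT_comp; first exact: measurable_expR.
    by apply: measurable_funN; exact: measurable_funM.
  - move=> x _; apply: cvg_EFin; first exact: nearW.
    apply: (@cvg_exhaust_left _ (fun s => g x * expR (- (s * x)))).
    have -> : g x = g x * expR (- x * 0) by rewrite mulr0 expR0 mulr1.
    apply: cvgM; first by rewrite mulr0 expR0 mulr1; exact: cvg_cst.
    have /is_derive1_continuous c := is_derive1_expRl (- x) 0.
    have := cvg_at_right_filter c.
    by apply: cvg_trans; apply: near_eq_cvg; apply: nearW => s; rewrite mulNr mulrC.
  - exact: integrable_abse.
  - move=> n x /half_lineP x0; rewrite /= lee_fin normrM ler_piMr//.
    rewrite ger0_norm ?expR_ge0// expR_le1 oppr_le0 mulr_ge0 ?invr_ge0//.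
    exact: ltW.
have H3 : F n.+2%:R^-1 @[n --> \oo] --> \int[leb]_(x in Rp) g x.
  apply: fine_cvg; rewrite /Rintegral fineK//.
  exact: integrable_fin_num gi.
exact: (cvg_unique _ H3 H1).
Qed.

End polynomial_integrals.

Section abel_moments.
Context {R : realType}.
Implicit Types (mu nu s x : R) (p P : {poly R}) (t m : nat -> R).
Local Notation leb := (@lebesgue_measure R).
Local Notation "'Rp'" := (`]0%R, +oo[%classic : set R).

(** The sign [(-1)^j] of the moments cancels the one produced by [nsq]. *)
Lemma polymom_nsq m t (kappa : R) r :
  (forall j, m (2 * j)%N = kappa * ((-1) ^+ j * t j)) ->
  polymom m (nsq r) = kappa * polymom t r.
Proof.
move=> mt; rewrite nsq_coefE linear_sum/= mulr_sumr; apply: eq_bigr => i _.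
rewrite linearZ/= nsqXn linearZ/= polymomXn mt.
have : (-1) ^+ i * (-1) ^+ i = 1 :> R by rewrite -expr2 sqrr_sign.
move: ((-1) ^+ i) => c cc.
by rewrite [LHS](_ : _ = kappa * (r`_i * t i) * (c * c)); [rewrite cc mulr1|ring].
Qed.

Lemma polymom_Xnsq m t (kappa : R) r :
  (forall j, m (2 * j).+1 = kappa * ((-1) ^+ j * t j)) ->
  polymom m ('X * nsq r) = kappa * polymom t r.
Proof.
move=> mt; rewrite nsq_coefE mulr_sumr linear_sum/= mulr_sumr.
apply: eq_bigr => i _.
rewrite -scalerAr linearZ/= nsqXn -scalerAr linearZ/= -exprS polymomXn mt.
have : (-1) ^+ i * (-1) ^+ i = 1 :> R by rewrite -expr2 sqrr_sign.
move: ((-1) ^+ i) => c cc.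
by rewrite [LHS](_ : _ = kappa * (r`_i * t i) * (c * c)); [rewrite cc mulr1|ring].
Qed.

Lemma bessel_laplace_fun (N : nat) mu nu s x k P : mu = N%:R + nu -> 0 < x ->
  P.[x] * x `^ (k%:R + mu) * besselJ nu x * expR (- (s * x)) =
  laplace_fun (N%:R + 2 * nu) nu s x * (P * 'X^k).[x].
Proof.
move=> -> x0; rewrite besselJE// /laplace_fun hornerM hornerXn.
have -> : N%:R + 2 * nu = N%:R + nu + nu by ring.
rewrite !gt0_powRD// (powR_mulrn k (ltW x0)).
by move: (besselF _ _) (x `^ nu) (x `^ _) (expR _) (P.[x]) => A B C D E; ring.
Qed.

Lemma laplace_funXn b nu s x j : 0 < x ->
  laplace_fun b nu s x * x ^+ j = laplace_fun (b + j%:R) nu s x.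
Proof.
move=> x0; rewrite /laplace_fun gt0_powRD// powR_mulrn ?ltW//.
by move: (besselF _ _) (_ `^ _) (expR _) => A B D; ring.
Qed.

(** For [s > 0] the integral is a finite combination of transforms [laplace] with known limits.
    Hence the Abel integral always exists, and the equivalence is uniqueness of the limit. *)
Lemma is_abel_bessel (N : nat) mu nu k P (l : R) : mu = N%:R + nu -> -1 < mu + nu ->
  is_abel_integral (fun x => P.[x] * x `^ (k%:R + mu) * besselJ nu x) l <->
  polymom (fun j => bessel_moment (N + j) nu) (P * 'X^k) = l.
Proof.
move=> muE munu.
have N1 j : -1 < (N + j)%:R + 2 * nu.
  by rewrite natrD; have := ler0n R j; lra.
have b1 j : N%:R + 2 * nu + j%:R = (N + j)%:R + 2 * nu by rewrite natrD; ring.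
have gi s j : 0 < s ->
    leb.-integrable Rp (EFin \o (fun x => laplace_fun (N%:R + 2 * nu) nu s x * x ^+ j)).
  move=> s0; apply: (half_line_integrable_eq (f := laplace_fun ((N + j)%:R + 2 * nu) nu s)).
    by move=> x x0; rewrite laplace_funXn// b1.
  exact: integrable_laplace_fun.
have E s : 0 < s -> leb.-integrable Rp
      (EFin \o (fun x => P.[x] * x `^ (k%:R + mu) * besselJ nu x * expR (- (s * x)))) /\
    \int[leb]_(x in Rp) (P.[x] * x `^ (k%:R + mu) * besselJ nu x * expR (- (s * x)))
      = polymom (fun j => laplace ((N + j)%:R + 2 * nu) nu s) (P * 'X^k).
  move=> s0; have [H1 H2] := half_line_Rintegral_poly (P * 'X^k) (fun j => gi s j s0).
  split.
    by apply: half_line_integrable_eq H1 => x x0; rewrite (bessel_laplace_fun _ _ _ muE).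
  transitivity (\int[leb]_(x in Rp) (laplace_fun (N%:R + 2 * nu) nu s x * (P * 'X^k).[x])).
    by apply: half_line_Rintegral_eq => x x0; rewrite (bessel_laplace_fun _ _ _ muE).
  rewrite H2.
  apply: eq_bigr => j _; congr (_ * _); apply: half_line_Rintegral_eq => x x0.
  by rewrite laplace_funXn// b1.
have L : (\int[leb]_(x in Rp) (P.[x] * x `^ (k%:R + mu) * besselJ nu x * expR (- (s * x))))
    @[s --> 0^'+] --> polymom (fun j => bessel_moment (N + j) nu) (P * 'X^k).
  apply: (@cvg_trans _ (polymom (fun j => laplace ((N + j)%:R + 2 * nu) nu s) (P * 'X^k)
      @[s --> 0^'+])).
    apply: near_eq_cvg; near=> s; rewrite (proj2 (E s _))//.
  rewrite /polymom; apply: cvg_big => [|j _]; first exact: add_continuous.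
  apply: cvgM; first exact: cvg_cst.
  exact: cvg_bessel_moment.
split=> [[_ h]|<-]; first exact: (cvg_unique _ L h).
by split => // s s0; exact: (proj1 (E s s0)).
Unshelve. all: end_near. Qed.

End abel_moments.

Section weight_functional.
Context {R : realType}.
Implicit Types (mu nu s x : R) (p : {poly R}).
Local Notation leb := (@lebesgue_measure R).
Local Notation "'Rp'" := (`]0%R, +oo[%classic : set R).

Definition weight_exponent mu nu : R :=
  if odd (Num.truncn (mu - nu)) then mu / 2 else (mu - 1) / 2.

Definition weight_moment mu nu (j : nat) : R :=
  2^-1 * besselK_moment nu (weight_exponent mu nu + j%:R).

Lemma weightE mu nu x : 0 < x ->
  weight mu nu x = 2^-1 * besselK_wfun nu (weight_exponent mu nu) x.
Proof.
by move=> x0; rewrite /weight /besselK_wfun /weight_exponent; case: ifP => _;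
  move: (besselK _ _) (_ `^ _) => A B; ring.
Qed.

Lemma weight_gt0 mu nu x : 0 < x -> 0 < weight mu nu x.
Proof. by move=> x0; rewrite weightE// mulr_gt0// besselK_wfun_gt0. Qed.

Section natural_difference.
Variables mu nu : R.
Hypotheses (hsum : -1 < mu + nu) (hdiff : mu - nu \is a Num.nat).
Let N := Num.truncn (mu - nu).

Lemma mu_natE : mu = N%:R + nu.
Proof. by rewrite /N (truncnK hdiff) subrK. Qed.

(** For even [N] and [j = 0] the right side is [mu + 1], and the two halves of [|nu| < mu + 1]
    follow from [mu + nu > -1] and [mu - nu >= 0]. Odd [N] adds 1, and [j] adds [2 j]. *)
Lemma weight_exponent_bound (j : nat) :
  `|nu| < 2 * (weight_exponent mu nu + j%:R) + 2.
Proof.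
have j0 : 0 <= j%:R :> R := ler0n _ _.
have N0 : 0 <= N%:R :> R := ler0n _ _.
have := mu_natE; rewrite ltr_norml /weight_exponent => E.
move: N0 E hsum; move: (N%:R) => n n0 E h.
by case: ifP => _; apply/andP; split; lra.
Qed.

Lemma weight_integrable (j : nat) :
  leb.-integrable Rp (EFin \o (fun x => weight mu nu x * x ^+ j)) /\
  \int[leb]_(x in Rp) (weight mu nu x * x ^+ j) = weight_moment mu nu j.
Proof.
have K := integrable_besselK_wfun (weight_exponent_bound j).
have e x : 0 < x ->
    2^-1 * besselK_wfun nu (weight_exponent mu nu + j%:R) x = weight mu nu x * x ^+ j.
  move=> x0; rewrite weightE// /besselK_wfun gt0_powRD// powR_mulrn ?ltW//.
  by move: (besselK _ _) (_ `^ _) => A B; ring.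
split; first exact: half_line_integrable_eq e (half_line_integrableZ _ K).
by rewrite -(half_line_Rintegral_eq e) half_line_RintegralZ.
Qed.

Lemma weight_poly p :
  leb.-integrable Rp (EFin \o (fun x => weight mu nu x * p.[x])) /\
  \int[leb]_(x in Rp) (weight mu nu x * p.[x]) = polymom (weight_moment mu nu) p.
Proof.
have [H1 ->] := half_line_Rintegral_poly p (fun j => proj1 (weight_integrable j)).
split=> //; apply: eq_bigr => j _; congr (_ * _); exact: (proj2 (weight_integrable j)).
Qed.

Lemma weight_poly_gt0 p : p != 0 -> (forall x, 0 < x -> 0 <= p.[x]) ->
  0 < polymom (weight_moment mu nu) p.
Proof.
move=> p0 pge0; have [H1 <-] := weight_poly p.
by apply: half_line_Rintegral_poly_gt0 => // x; exact: weight_gt0.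
Qed.

Lemma weight_abel p q (l : R) :
  is_abel_integral (fun x => weight mu nu x * p.[x] * q.[x]) l ->
  polymom (weight_moment mu nu) (p * q) = l.
Proof.
have [H1 <-] := weight_poly (p * q).
move=> [_ h]; apply: (abel_limit_integrable H1).
apply: cvg_trans h; apply: near_eq_cvg; apply: nearW => s.
by apply: half_line_Rintegral_eq => x _; rewrite hornerM mulrA.
Qed.

Lemma weight_momentS j : weight_moment mu nu j.+1 =
  ((2 * (weight_exponent mu nu + j%:R) + 2) ^+ 2 - nu ^+ 2) * weight_moment mu nu j.
Proof.
rewrite /weight_moment -[j.+1%:R]natr1 addrA besselK_momentS; first by rewrite mulrCA.
exact: weight_exponent_bound.
Qed.

(* The two moment sequences satisfy the same recurrence up to a sign. *)
Lemma bessel_weight_moment : exists2 kappa : R, kappa != 0 & forall j,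
  bessel_moment (N + odd N + 2 * j) nu = kappa * ((-1) ^+ j * weight_moment mu nu j).
Proof.
have muE := mu_natE.
have N1 k : -1 < (N + k)%:R + 2 * nu.
  by rewrite natrD; have := ler0n R k; have := hsum; lra.
have t0 : weight_moment mu nu 0 != 0.
  rewrite gt_eqF// -(polymomXn (weight_moment mu nu) 0) expr0.
  by apply: weight_poly_gt0 => [|x _]; rewrite ?oner_neq0// hornerC ler01.
pose m0 := bessel_moment (N + odd N) nu.
have m00 : m0 != 0.
  by rewrite /m0 bessel_moment_eq0// oddD oddb addbb.
(* The ratio of the initial terms; the numerator is nonzero because [N + odd N] is even. *)
exists (m0 / weight_moment mu nu 0); first by rewrite mulf_neq0 ?invr_eq0.
elim=> [|j IH].
  by rewrite muln0 addn0 expr0 mul1r divfK.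
rewrite mulnS addnCA add2n bessel_momentSS; last by rewrite -addnA.
rewrite IH exprS weight_momentS.
(* With [e = odd N], the factor of [weight_momentS] becomes [(mu + 1 + e + 2 j)^2 - nu^2]; as a
   difference of squares it splits into the two factors of [bessel_momentSS] at
   [n = N + e + 2 j]. *)
have -> : weight_exponent mu nu = (mu - 1 + (odd N)%:R) / 2.
  by rewrite /weight_exponent -/N; case: (odd N); rewrite /= ?subrK ?addr0.
have -> : (N + odd N + 2 * j).+1%:R = mu - nu + (odd N)%:R + 2 * j%:R + 1 :> R.
  rewrite -[LHS]natr1 natrD [(2 * j)%:R]natrM [(N + odd N)%:R]natrD [in RHS]muE.
  by ring.
move: (m0 / _) ((-1) ^+ j) (weight_moment mu nu j) => A B D.
by field.
Qed.

Lemma bessel_moment_odd_shift j : bessel_moment (N + ~~ odd N + 2 * j) nu = 0.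
Proof.
apply/eqP; rewrite bessel_moment_eq0.
  by rewrite oddD mul2n odd_double addbF oddD oddb; case: (odd N).
rewrite -addnA natrD; have := ler0n R (~~ odd N + 2 * j).
by have := hsum; have := mu_natE; lra.
Qed.

End natural_difference.
End weight_functional.

Theorem theorem3p5 (R : realType) (nu mu : R)
    (hsum : -1 < mu + nu) (hdiff : mu - nu \is a Num.nat)
    (phi : nat -> {poly R}) (hphi : is_monic_OPS (weight mu nu) phi) :
  (~~ odd (Num.truncn (mu - nu)) ->
     forall n : nat,
       [/\ exists! P : {poly R}, is_bessel_OP mu nu (2 * n) P,
           forall P : {poly R}, is_bessel_OP mu nu (2 * n) P ->
             forall x : R, P.[x] = (-1) ^+ n * (phi n).[- x ^+ 2],
           exists! P : {poly R}, is_bessel_OP mu nu (2 * n + 1) P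
         & forall P : {poly R}, is_bessel_OP mu nu (2 * n + 1) P ->
             forall x : R, x != 0 ->
               P.[x] = (-1) ^+ n.+1 / x *
                 ((phi n.+1).[- x ^+ 2]
                  - (phi n.+1).[0] / (phi n).[0] * (phi n).[- x ^+ 2])]) /\
  (odd (Num.truncn (mu - nu)) ->
     forall n : nat,
       [/\ exists! P : {poly R}, is_bessel_OP mu nu (2 * n) P,
           forall P : {poly R}, is_bessel_OP mu nu (2 * n) P ->
             forall x : R, P.[x] = (-1) ^+ n * (phi n).[- x ^+ 2]
         & ~ exists P : {poly R}, is_bessel_OP mu nu (2 * n + 1) P]).
Proof.
pose N := Num.truncn (mu - nu).
pose L : {scalar {poly R}} := polymom (weight_moment mu nu).
pose B : {scalar {poly R}} := polymom (fun j => bessel_moment (N + j) nu).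
have phi_monic n : phi n \is monic by have [] := hphi.1 n.
have size_phi n : size (phi n) = n.+1 by have [] := hphi.1 n.
have phi_orth n m : n != m -> L (phi n * phi m) = 0.
  by move=> /hphi.2 /weight_abel; exact.
have L_sqr p : p != 0 -> L (p * p) != 0.
  move=> p0; rewrite gt_eqF//; apply: weight_poly_gt0 => //.
    by rewrite mulf_neq0.
  by move=> x _; rewrite hornerM -expr2 sqr_ge0.
have L_Xsqr p : p != 0 -> L ('X * (p * p)) != 0.
  move=> p0; rewrite gt_eqF//; apply: weight_poly_gt0 => //.
    by rewrite !mulf_neq0// polyX_eq0.
  by move=> x x0; rewrite !hornerM hornerX mulr_ge0 ?(ltW x0)// -expr2 sqr_ge0.
have [kappa k0 hk] := bessel_weight_moment hsum hdiff.
have hz := bessel_moment_odd_shift hsum hdiff.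
have OPP n P : is_bessel_OP mu nu n P <-> [/\ P \is monic, size P = n.+1 & bessel_orth B n P].
  have E k := is_abel_bessel k P 0 (mu_natE hdiff) hsum.
  split=> [[[mP sP] h]|[mP sP h]]; do ?split => // k kn; exact/E/h.
(* The difference of two monic polynomials of degree [n] has size at most [n], so uniqueness reduces
   to the absence of nonzero orthogonal polynomials of that size. *)
have uniq n P0 : [/\ P0 \is monic, size P0 = n.+1 & bessel_orth B n P0] ->
    (forall q : {poly R}, (size q <= n)%N -> bessel_orth B n q -> q = 0) ->
    forall P, is_bessel_OP mu nu n P -> P0 = P.
  move=> [mP0 sP0 oP0] hu P /OPP[mP sP oP]; apply/eqP; rewrite -subr_eq0; apply/eqP.
  apply: hu; last by move=> k kn; rewrite mulrBl raddfB/= oP0// oP// subrr.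
  apply/leq_sizeP => j; rewrite leq_eqVlt => /predU1P[<-|nj]; rewrite coefB.
    move: mP0 mP; rewrite !monicE /lead_coef sP0 sP /= => /eqP -> /eqP ->.
    by rewrite subrr.
  by rewrite !nth_default ?subrr ?sP0 ?sP.
split=> [evenN|oddN] n.
- have B_nsq r : B (nsq r) = kappa * L r.
    by apply: polymom_nsq => j; rewrite -hk -/N (negbTE evenN) addn0.
  have B_Xnsq r : B ('X * nsq r) = 0.
    (* Taking [kappa = 0] turns vanishing moments of one parity into the vanishing of [B] on that
       part. *)
    rewrite [LHS](@polymom_Xnsq _ _ (weight_moment mu nu) 0) ?mul0r// => j.
    by have := hz j; rewrite -/N evenN addn1 addSnnS mul0r.
  have [me se] := even_sol_monic phi_monic size_phi n.
  have oe : bessel_orth B (2 * n) (even_sol phi n).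
    exact: (even_even_orth phi_monic size_phi phi_orth B_nsq B_Xnsq).
  have [q [mq sq oq hq]] :=
    even_odd_sol phi_monic size_phi phi_orth L_Xsqr B_nsq B_Xnsq n.
  have ue := uniq _ _ (And3 me se oe) (@even_unique _ _ _ _ L_sqr L_Xsqr k0 B_nsq B_Xnsq _).
  have uq := uniq _ _ (And3 mq sq oq) (@even_unique _ _ _ _ L_sqr L_Xsqr k0 B_nsq B_Xnsq _).
  split.
  + by exists (even_sol phi n); split => //; apply/OPP.
  + by move=> P /ue <- x; rewrite even_solE.
  + by exists q; split => //; apply/OPP.
  + by move=> P /uq <-.
- have B_nsq r : B (nsq r) = 0.
    rewrite [LHS](@polymom_nsq _ _ (weight_moment mu nu) 0) ?mul0r// => j.
    by have := hz j; rewrite -/N oddN addn0 mul0r.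
  have B_Xnsq r : B ('X * nsq r) = kappa * L r.
    by apply: polymom_Xnsq => j; rewrite -hk -/N oddN addn1 addSnnS.
  have [me se] := even_sol_monic phi_monic size_phi n.
  have oe : bessel_orth B (2 * n) (even_sol phi n).
    exact: (odd_even_orth phi_monic size_phi phi_orth B_nsq B_Xnsq).
  have ue := uniq _ _ (And3 me se oe) (@odd_unique _ _ _ _ L_sqr k0 B_nsq B_Xnsq n).
  split.
  + by exists (even_sol phi n); split => //; apply/OPP.
  + by move=> P /ue <- x; rewrite even_solE.
  + by move=> [P /OPP[mP sP oP]]; exact: (odd_no_sol L_sqr k0 B_nsq B_Xnsq sP oP).
Qed.
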